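(* Let $(X,Y,\langle\cdot,\cdot\rangle)$ be a dual pair of normed vector spaces such that $|\langle x,y\rangle|\le\|x\|\,\|y\|$ for all $x\in X$, $y\in Y$, and such that $\{x\in X:\|x\|\le1\}$ is $\sigma(X,Y)$-closed and $\{y\in Y:\|y\|\le1\}$ is $\sigma(Y,X)$-closed. Then there exists a unique conditional bilinear form $\langle\cdot,\cdot\rangle_{\mathbf c}$ on $\mathbf{X_c}\times\mathbf{Y_c}$ with $\langle x,y\rangle_c=\langle x,y\rangle$ for all $x\in X$ and $y\in Y$ such that $(\mathbf{X_c},\mathbf{Y_c},\langle\cdot,\cdot\rangle_{\mathbf c})$ is a conditional dual pair.
   Context: Fix a complete non-degenerate Boolean algebra $\mathcal{A}=(\mathcal{A},\wedge,\vee,{}^c,0,1)$, with $a\le b$ iff $a\wedge b=a$. A partition is a family $(a_i)$ in $\mathcal{A}$ with $a_i\wedge a_j=0$ for $i\ne j$ and $\vee a_i=1$ (entries may be $0$). Conditional sets. A conditional set of a non-empty set $X$ and $\mathcal{A}$ is a collection $\mathbf{X}$ of objects $x|a$ ($x\in X$, $a\in\mathcal{A}$) such that (C1) $x|b=y|a$ implies $a=b$; (C2) $x|b=y|b$ and $a\le b$ imply $x|a=y|a$; (C3) for each partition $(a_i)$ and each family $(x_i)$ in $X$ there is a unique $x\in X$ with $x|a_i=x_i|a_i$ for all $i$; it is written $x=\sum x_i|a_i$ (concatenation). A conditional set $\mathbf{X}$ is written in bold and the underlying set inducing it in plain type; conditional elements of $\mathbf{X}$ correspond to elements of $X$. Products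 carry componentwise concatenation. A function $f:X\to Y$ between sets inducing conditional sets is stable if $f(\sum x_i|a_i)=\sum f(x_i)|a_i$; conditional functions $\mathbf{f}:\mathbf{X}\to\mathbf{Y}$ are those induced by stable functions. Step functions. For a non-empty set $E$, $E_s$ is the set of families $(x_i,a_i)$ in $E\times\mathcal{A}$ with $(a_i)$ a partition, where $(x_i,a_i)$ and $(y_j,b_j)$ are identified if $\vee\{a_i:x_i=z\}=\vee\{b_j:y_j=z\}$ for all $z\in E$; two classes agree on $a$ if these identities hold after meeting both sides with $a$. $E_s$ induces a conditional set, elements are written $\sum x_i|a_i$, and $E$ is embedded as the constants $x|1$. Conditional real numbers. On $\mathbb{R}_s$: $\sum x_i|a_i\leqslant\sum y_j|b_j$ (resp. $<$) iff $x_i\le y_j$ (resp. $x_i<y_j$) whenever $a_i\wedge b_j>0$; sum, product and absolute value are taken pointwise on the common refinement. $\mathbb{N}_s\subseteq\mathbb{R}_s$ carries the inherited order. A conditional sequence in $\mathbf{X}$ is a stable function $\mathbb{N}_s\to X$, $n\mapsto x_n$. The conditional real numbers $\mathbf{R}$ are induced by the set $R$ of conditional Cauchy sequences $(x_n)$ in $\mathbb{R}_s$ (for every $r\in\mathbb{R}_s$, $r>0$, there is $n_0\in\mathbb{N}_s$ with $|x_m-x_n|<r$ for all $m,n\geqslant n_0$), with $(x_n),(y_n)$ identified if $|x_n-y_n|$ converges to $0$ (for every $r\in\mathbb{R}_s$, $r>0$, there is $n_0\in\mathbb{N}_s$ with $|x_n-y_n|<r$ for all $n\geqslant n_0$; agreement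 on $a$ is the same condition with the inequality required on $a$ only). Operations, absolute value and concatenations are defined representative-wise. $[(x_n)]\leqslant[(y_n)]$ iff for all $r\in\mathbb{R}_s$, $r>0$, there is $n\in\mathbb{N}_s$ with $y_m-x_m>-r$ for all $m\geqslant n$; $[(x_n)]<[(y_n)]$ iff there are $r\in\mathbb{R}_s$, $r>0$, and $n\in\mathbb{N}_s$ with $y_m-x_m>r$ for all $m\geqslant n$. $R_+=\{x\in R:x\geqslant0\}$. $\mathbb{R}\subseteq\mathbb{R}_s\subseteq R$. Conditional completion of a normed space. For a normed space $X$, $X_s$ carries the pointwise operations and the stable $\mathbb{R}_s$-valued norm $\|\sum x_i|a_i\|_s=\sum\|x_i\||a_i$. $X_c$ is the set of conditional Cauchy sequences in $X_s$ (Cauchy: for every $r\in\mathbb{R}_s$, $r>0$, there is $n_0\in\mathbb{N}_s$ with $\|x_m-x_n\|_s<r$ for $m,n\geqslant n_0$) modulo $\|x_n-y_n\|_s\to0$; it induces the conditional completion $\mathbf{X_c}$, which with representative-wise addition, scalar multiplication by $R$ and concatenation, and with norm $\|[(x_n)]\|_c=\lim_n\|x_n\|_s\in R_+$, is a conditional Banach space. One identifies $X\subseteq X_s\subseteq X_c$ via constants. Similarly for $Y$. Dual pairs. A (classical) dual pair is a pair of real vector spaces with a real bilinear form separating points on both sides; $\sigma(X,Y)$ is the weak topology induced on $X$ by $Y$, and $\sigma(Y,X)$ the one induced on $Y$ by $X$. A conditional bilinear form on $\mathbf{X_c}\times\mathbf{Y_c}$ is a conditional function induced by a stable $R$-bilinear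 function $\langle\cdot,\cdot\rangle_c: X_c\times Y_c\to R$. $(\mathbf{X_c},\mathbf{Y_c},\langle\cdot,\cdot\rangle_{\mathbf c})$ is a conditional dual pair if the form separates points: $\langle x,y\rangle_c=0$ for all $y\in Y_c$ implies $x=0$, and $\langle x,y\rangle_c=0$ for all $x\in X_c$ implies $y=0$.
   Formalization: The form is also required to be norm-bounded, |<x,y>_c| ≤ k||x||_c||y||_c for some k in R, and is unique among such forms; without this uniqueness fails (A={0,1}, X=Y=c_00 with the l2 norm: add φ(x)φ(y), φ≠0 linear on l2 vanishing on c_00). *)

(* Defs.v *)
From HB Require Import structures.
From mathcomp Require Import all_boot all_order all_algebra.
From mathcomp Require Import all_classical all_reals all_analysis.
From mathcomp Require Import lra.

Set Implicit Arguments.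
Unset Strict Implicit.
Unset Printing Implicit Defensive.

Import Order.Theory GRing.Theory Num.Theory.
Import numFieldNormedType.Exports.

Local Open Scope classical_set_scope.
Local Open Scope ring_scope.

(** * Complete non-degenerate Boolean algebras *)

HB.mixin Record CTBDistrLattice_isComplete d A of Order.CTBDistrLattice d A := {
  has_supremums : forall S : set A, supremums S !=set0;
  bottom_neq_top : (\bot%O : A) <> \top%O
}.

#[short(type="cbaType")]
HB.structure Definition CompleteBooleanAlgebra d :=
  {A of Order.CTBDistrLattice d A & CTBDistrLattice_isComplete d A}.

Section BooleanAlgebra.
Context {d : Order.disp_t} {A : cbaType d}.
Implicit Types (a b c : A) (S : set A).

Definition vee S : A := supremum \bot%O S.

Definition is_partition (I : Type) (a : I -> A) : Prop :=
  (forall i j, i <> j -> (a i `&` a j)%O = \bot%O) /\ vee (range a) = \top%O.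

Lemma vee_ub S a : S a -> (a <= vee S)%O.
Proof.
move=> Sa; rewrite /vee /supremum; case: ifPn => [/eqP S0|_].
  by move: Sa; rewrite S0.
have [x Sx] := has_supremums S; case: xgetP => [y _ [Sy _]|/(_ x)//].
exact: Sy.
Qed.

Lemma vee_le S b : (forall a, S a -> (a <= b)%O) -> (vee S <= b)%O.
Proof.
move=> Sb; rewrite /vee /supremum; case: ifPn => [_|_]; first exact: le0x.
have [x Sx] := has_supremums S; case: xgetP => [y _ [_ Sy]|/(_ x)//].
exact: Sy.
Qed.

Lemma bot_lt a : ((\bot < a)%O : Prop) <-> a <> \bot%O.
Proof. by rewrite lt0x; split=> [/eqP|/eqP]. Qed.

Lemma le_by_meets a b :
  (forall c, c <> \bot%O -> (c <= a)%O -> (c `&` b)%O <> \bot%O) -> (a <= b)%O.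
Proof.
move=> h; apply: contrapT => /negP nab.
have c0 : (a `\` b)%O <> \bot%O by move/eqP; rewrite diff_eq0 (negPf nab).
by apply: (h _ c0 (leBx _ _)); rewrite meetC diffKI.
Qed.

Lemma vee_pick S b : (b <= vee S)%O -> b <> \bot%O ->
  exists2 a, S a & (b `&` a)%O <> \bot%O.
Proof.
move=> bS b0; apply: contrapT => h; apply: b0; apply/eqP.
have : (vee S <= ~` b)%O.
  apply: vee_le => a Sa; rewrite -disj_leC.
  apply/eqP; apply: contrapT => ab; apply: h; exists a => //.
  by rewrite meetC.
by move=> /(le_trans bS); rewrite -disj_leC meetxx.
Qed.

Lemma partition_pick (I : Type) (a : I -> A) b : is_partition a ->
  b <> \bot%O -> exists i, (b `&` a i)%O <> \bot%O.
Proof.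
move=> [_ a1] b0; have /vee_pick/(_ b0)[_ [i _ <-] ?] : (b <= vee (range a))%O.
  by rewrite a1 lex1.
by exists i.
Qed.

Lemma partition_inj (I : Type) (a : I -> A) b i j : is_partition a ->
  b <> \bot%O -> (b <= a i)%O -> (b <= a j)%O -> i = j.
Proof.
move=> [aI _] b0 bi bj; apply: contrapT => /aI ij; apply: b0.
by apply/eqP; rewrite -lex0 -ij lexI bi.
Qed.

Lemma mk_partition (I : Type) (a : I -> A) :
  (forall b i j, b <> \bot%O -> (b <= a i)%O -> (b <= a j)%O -> i = j) ->
  (forall b, b <> \bot%O -> exists i, (b `&` a i)%O <> \bot%O) ->
  is_partition a.
Proof.
move=> ai ap; split=> [i j ij|].
  apply: contrapT => /ai h; apply: ij; apply: h; [exact: leIl|exact: leIr].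
apply/eqP; rewrite -le1x; apply: le_by_meets => c c0 _.
have [i ci] := ap _ c0; apply: contra_not ci => h.
apply/eqP; rewrite -lex0 -h leI2//; apply: vee_ub; exact: imageT.
Qed.

End BooleanAlgebra.

(** * Conditional sets *)

(* [restr x a] is the object $x|a$; the three numbered conditions are (C1),
   (C2) and (C3). *)
Record condSet {d : Order.disp_t} (A : cbaType d) := CondSet {
  cs_sort :> Type;
  cs_obj : Type;
  restr : cs_sort -> A -> cs_obj;
  cs_inhabited : inhabited cs_sort;
  restr_C1 : forall x y a b, restr x b = restr y a -> a = b;
  restr_C2 : forall x y a b,
    restr x b = restr y b -> (a <= b)%O -> restr x a = restr y a;
  restr_C3 : forall (I : Type) (a : I -> A) (x_ : I -> cs_sort),
    is_partition a ->
    exists! x, forall i, restr x (a i) = restr (x_ i) (a i)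
}.

Section ConditionalSets.
Context {d : Order.disp_t} {A : cbaType d}.
Implicit Types (X Y : condSet A) (a b : A).

(* The concatenation $\sum x_i|a_i$. *)
Definition concat X (I : Type) (a : I -> A) (pa : is_partition a)
  (x_ : I -> X) : X := projT1 (cid (restr_C3 x_ pa)).

Lemma concatP X (I : Type) (a : I -> A) (pa : is_partition a) (x_ : I -> X) i :
  restr (concat pa x_) (a i) = restr (x_ i) (a i).
Proof. by rewrite /concat; case: cid => x [/= h _]. Qed.

Lemma concat_uniq X (I : Type) (a : I -> A) (pa : is_partition a)
  (x_ : I -> X) x :
  (forall i, restr x (a i) = restr (x_ i) (a i)) -> x = concat pa x_.
Proof. by move=> h; rewrite /concat; case: cid => y [/= _ /(_ _ h)]. Qed.

Definition stable X Y (f : X -> Y) : Prop :=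
  forall (I : Type) (a : I -> A) (pa : is_partition a) (x_ : I -> X),
    f (concat pa x_) = concat pa (f \o x_).

Lemma restr_eq1 X (x y : X) : restr x \top%O = restr y \top%O -> x = y.
Proof.
move=> xy; have p1 : is_partition (fun _ : unit => \top%O : A).
  by apply: mk_partition => [? [] []//|b b0]; exists tt; rewrite meetx1.
rewrite (@concat_uniq _ _ _ p1 (fun=> x) x)//.
by rewrite [RHS](@concat_uniq _ _ _ p1 (fun=> x) y).
Qed.

Lemma partition_compl a : is_partition (fun t : bool => if t then a else (~` a)%O).
Proof.
apply: mk_partition => [b|b b0].
  suff h : b <> \bot%O -> (b <= a)%O -> (b <= ~` a)%O -> False.
    by move=> [] []//= b0 ? ?; case: h.
  by move=> b0 ba bca; apply: b0; apply/eqP; rewrite -lex0 -(meetxC a) lexI ba.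
apply: contrapT => h; apply: b0; apply/eqP.
have /eqP : (b `&` a)%O = \bot%O.
  by apply: contrapT => ?; apply: h; exists true.
rewrite disj_leC => /meet_l {1}<-.
by apply/eqP; apply: contrapT => ?; apply: h; exists false.
Qed.

Lemma stable_restr X Y (f : X -> Y) : stable f <->
  forall x y a, restr x a = restr y a -> restr (f x) a = restr (f y) a.
Proof.
split=> [fs x y a xy|fl I a pa x_]; last first.
  by apply: concat_uniq => i; apply: fl; exact: concatP.
pose p t := if t then x else y; have pa := partition_compl a.
have -> : y = concat pa p by apply: concat_uniq => -[].
by rewrite fs; have /= <- := concatP pa (f \o p) true.
Qed.

Lemma prod_C3 X Y (I : Type) (a : I -> A) (p_ : I -> X * Y) :
  is_partition a -> exists! p : X * Y,
    forall i, (restr p.1 (a i), restr p.2 (a i)) =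
              (restr (p_ i).1 (a i), restr (p_ i).2 (a i)).
Proof.
move=> pa; exists (concat pa (fst \o p_), concat pa (snd \o p_)); split.
  by move=> i /=; rewrite !concatP.
move=> [x y] /= h; congr pair; apply/esym.
  by apply: concat_uniq => i; case: (h i).
by apply: concat_uniq => i; case: (h i).
Qed.

Definition prodCS X Y : condSet A.
Proof.
apply: (@CondSet _ _ (X * Y)%type (cs_obj X * cs_obj Y)%type
  (fun p a => (restr p.1 a, restr p.2 a))).
- by case: (cs_inhabited X) => x; case: (cs_inhabited Y).
- by move=> x y a b [/restr_C1].
- by move=> x y a b [h1 h2] ab; congr pair; apply: restr_C2; eassumption.
- exact: prod_C3.
Defined.

(* A conditional set given by the relation "[x] and [y] agree on [a]": the
   object $x|a$ is [a] together with the class of [x] for agreement on [a]. *)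
Section OfAgreement.
Variables (T : Type) (agree : A -> T -> T -> Prop).
Hypotheses (Tinh : inhabited T)
  (agree_refl : forall a x, agree a x x)
  (agree_sym : forall a x y, agree a x y -> agree a y x)
  (agree_trans : forall a x y z, agree a x y -> agree a y z -> agree a x z)
  (agree_mono : forall a b x y, agree b x y -> (a <= b)%O -> agree a x y)
  (agree_concat : forall (I : Type) (a : I -> A) (x_ : I -> T),
    is_partition a -> exists! x, forall i, agree (a i) x (x_ i)).

Definition agree_restr (x : T) (a : A) : A * set T := (a, agree a x).

Lemma agree_restrE x y a : agree_restr x a = agree_restr y a <-> agree a x y.
Proof.
split=> [[h]|h]; first by rewrite h.
congr pair; apply/funext => z; apply/propext; split; apply: agree_trans => //.
exact: agree_sym.
Qed.

Definition agreeCS : condSet A.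
Proof.
apply: (@CondSet _ _ T _ agree_restr) => //.
- by move=> x y a b [].
- by move=> x y a b /agree_restrE h ab; apply/agree_restrE/agree_mono/ab.
- move=> I a x_ /agree_concat - /(_ x_)[x [h u]]; exists x; split.
    by move=> i; apply/agree_restrE.
  by move=> y yP; apply: u => i; apply/agree_restrE.
Defined.

End OfAgreement.

End ConditionalSets.

(** * Step functions *)

Section Steps.
Context {d : Order.disp_t} (A : cbaType d).

(* The class of a family $(x_i,a_i)$ is determined by its invariant
   $z\mapsto\vee\{a_i : x_i = z\}$, which is itself a partition indexed by [E];
   [step] is the type of these invariants, and [step_of] sends a family to its
   class (see [step_of_eq] and [step_ofP]). *)
Record step (E : Type) := Step {
  coef :> E -> A;
  coef_partition : is_partition coef
}.

Lemma step_eq (E : Type) (x y : step E) : (forall z, x z = y z) -> x = y.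
Proof.
case: x y => [x px] [y py] /= /funext xy; subst y.
by rewrite (Prop_irrelevance px py).
Qed.

Definition step_coef (E I : Type) (x : I -> E) (a : I -> A) (z : E) : A :=
  vee [set a i | i in [set i | x i = z]].

Lemma step_coef_ge (E I : Type) (x : I -> E) (a : I -> A) i :
  (a i <= step_coef x a (x i))%O.
Proof. by apply: vee_ub; exists i. Qed.

Lemma step_coef_pick (E I : Type) (x : I -> E) (a : I -> A) z b :
  b <> \bot%O -> (b <= step_coef x a z)%O ->
  exists2 i, x i = z & (b `&` a i)%O <> \bot%O.
Proof. by move=> b0 /vee_pick/(_ b0)[_ [i xi <-] h]; exists i. Qed.

Lemma step_coef_partition (E I : Type) (x : I -> E) (a : I -> A) :
  is_partition a -> is_partition (step_coef x a).
Proof.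
move=> pa; apply: mk_partition => [b u v b0 bu bv|b b0].
  have [i <- bi] := step_coef_pick b0 bu.
  have [j <- bij] := step_coef_pick bi (le_trans (leIl _ _) bv).
  congr x; apply: (partition_inj pa bij); last exact: leIr.
  by rewrite (le_trans (leIl _ _))// leIr.
have [i bi] := partition_pick pa b0; exists (x i).
apply: contra_not bi => h; apply/eqP; rewrite -lex0 -h leI2//.
exact: step_coef_ge.
Qed.

Definition step_of (E I : Type) (x : I -> E) (a : I -> A)
  (pa : is_partition a) : step E := Step (step_coef_partition x pa).

Lemma step_of_eq (E I J : Type) (x : I -> E) (a : I -> A) (y : J -> E)
  (b : J -> A) (pa : is_partition a) (pb : is_partition b) :
  step_of x pa = step_of y pb <->
  forall z, vee [set a i | i in [set i | x i = z]] =
            vee [set b j | j in [set j | y j = z]].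
Proof.
split=> [h z|h]; last exact: step_eq.
by rewrite -[LHS]/(step_of x pa z) h.
Qed.

Lemma step_ofP (E : Type) (x : step E) :
  exists (I : Type) (y : I -> E) (a : I -> A) (pa : is_partition a),
    x = step_of y pa.
Proof.
exists E, id, x, (coef_partition x); apply: step_eq => z /=.
apply/eqP; rewrite eq_le (step_coef_ge id)/=.
by apply: vee_le => _ [_ -> <-].
Qed.

Lemma step_of_le (E I : Type) (x : I -> E) (a : I -> A)
  (pa : is_partition a) b i :
  (b <= a i)%O -> (b <= step_of x pa (x i))%O.
Proof. by move=> /le_trans; apply; exact: step_coef_ge. Qed.

Lemma step_pick (E : Type) (x : step E) b : b <> \bot%O ->
  exists c u, [/\ c <> \bot%O, (c <= b)%O & (c <= x u)%O].
Proof.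
move=> /(partition_pick (coef_partition x))[u bu].
by exists (b `&` x u)%O, u; split=> //; [exact: leIl|exact: leIr].
Qed.

Lemma step_inj (E : Type) (x : step E) b u v :
  b <> \bot%O -> (b <= x u)%O -> (b <= x v)%O -> u = v.
Proof. exact: partition_inj (coef_partition x). Qed.

(* Two classes agree on [a]. *)
Definition step_agree (E : Type) (a : A) (x y : step E) : Prop :=
  forall z, (x z `&` a)%O = (y z `&` a)%O.

Lemma step_agreeP (E : Type) a (x y : step E) : step_agree a x y <->
  forall b u v, b <> \bot%O -> (b <= a)%O -> (b <= x u)%O -> (b <= y v)%O ->
    u = v.
Proof.
split=> [xy b u v b0 ba bu bv|h z].
  by apply: (step_inj b0 _ bv); rewrite (le_trans _ (leIl _ a))// -xy lexI bu.
have aux (x' y' : step E) : (forall b u v, b <> \bot%O -> (b <= a)%O ->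
    (b <= x' u)%O -> (b <= y' v)%O -> u = v) -> (x' z `&` a <= y' z `&` a)%O.
  move=> h'; rewrite lexI leIr andbT; apply: le_by_meets => c c0.
  rewrite lexI => /andP[cz ca].
  have [b [v [b0 bc bv]]] := step_pick y' c0.
  have -> : z = v by apply: (h' b) => //; exact: le_trans bc _.
  by apply: contra_not b0 => cb; apply/eqP; rewrite -lex0 -cb lexI bc.
apply/eqP; rewrite eq_le !aux// => b u v b0 ba bu bv.
by apply/esym; exact: (h b).
Qed.

Lemma step_agree_intro (E : Type) a (x y : step E) :
  (forall b, b <> \bot%O -> (b <= a)%O ->
    exists c u, [/\ c <> \bot%O, (c <= b)%O, (c <= x u)%O & (c <= y u)%O]) ->
  step_agree a x y.
Proof.
move=> h; apply/step_agreeP => b u v b0 ba bu bv.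
have [c [w [c0 cb cu cv]]] := h b b0 ba.
by rewrite (step_inj c0 (le_trans cb bu) cu) (step_inj c0 (le_trans cb bv) cv).
Qed.

Lemma concat_partition (E I : Type) (a : I -> A) (x_ : I -> step E) :
  is_partition a -> is_partition (fun p : I * E => (a p.1 `&` x_ p.1 p.2)%O).
Proof.
move=> pa; apply: mk_partition => [b [i u] [j v] b0|b b0] /=.
  rewrite !lexI => /andP[bi bu] /andP[bj bv].
  have ij := partition_inj pa b0 bi bj; subst j.
  by rewrite (step_inj b0 bu bv).
have [i bi] := partition_pick pa b0.
have [u] := partition_pick (coef_partition (x_ i)) bi.
by rewrite -meetA; exists (i, u).
Qed.

Definition step_concat (E I : Type) (a : I -> A) (pa : is_partition a)
  (x_ : I -> step E) : step E := step_of snd (concat_partition x_ pa).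

Lemma step_concatP (E I : Type) (a : I -> A) (pa : is_partition a)
  (x_ : I -> step E) i : step_agree (a i) (step_concat pa x_) (x_ i).
Proof.
apply: step_agree_intro => b b0 ba.
have [c [u [c0 cb cu]]] := step_pick (x_ i) b0.
exists c, u; split=> //; apply: (@step_of_le _ _ snd _ _ _ (i, u)) => /=.
by rewrite lexI cu (le_trans cb).
Qed.

Lemma step_agree_trans (E : Type) a (x y z : step E) :
  step_agree a x y -> step_agree a y z -> step_agree a x z.
Proof. by move=> xy yz u; rewrite xy yz. Qed.

Lemma step_C3 (E I : Type) (a : I -> A) (x_ : I -> step E) :
  is_partition a -> exists! x, forall i, step_agree (a i) x (x_ i).
Proof.
move=> pa; exists (step_concat pa x_); split; first exact: step_concatP.
move=> y yP; apply: step_eq => z.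
suff /(_ z) : step_agree \top%O (step_concat pa x_) y by rewrite !meetx1.
apply/step_agreeP => b u v b0 _ bu bv; have [i bi] := partition_pick pa b0.
have : step_agree (a i) (step_concat pa x_) y.
  by apply: step_agree_trans (step_concatP _ _ i) _ => w; rewrite yP.
move=> /step_agreeP; apply; [exact: bi|exact: leIr| |].
  by rewrite (le_trans (leIl _ _)).
by rewrite (le_trans (leIl _ _)).
Qed.

Lemma unit_partition : is_partition (fun _ : unit => \top%O : A).
Proof.
by apply: mk_partition => [? [] []//|b b0]; exists tt; rewrite meetx1.
Qed.

(* The constant $e|1$. *)
Definition step_cst (E : Type) (e : E) : step E :=
  step_of (fun=> e) unit_partition.

Lemma step_cst_le (E : Type) (e : E) b : (b <= step_cst e e)%O.
Proof. exact: (@step_of_le _ _ (fun=> e) _ unit_partition b tt (lex1 b)). Qed.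

Lemma step_agree_refl (E : Type) a (x : step E) : step_agree a x x.
Proof. by []. Qed.

Lemma step_agree_sym (E : Type) a (x y : step E) :
  step_agree a x y -> step_agree a y x.
Proof. by move=> xy z; rewrite xy. Qed.

Lemma step_agree_mono (E : Type) a b (x y : step E) :
  step_agree b x y -> (a <= b)%O -> step_agree a x y.
Proof. by move=> xy /meet_r ab z; rewrite -ab !meetA xy. Qed.

Definition stepCS (E : pointedType) : condSet A :=
  agreeCS (inhabits (step_cst (point : E))) (@step_agree_refl E)
    (@step_agree_sym E) (@step_agree_trans E) (@step_agree_mono E) (@step_C3 E).

Lemma stepCS_restr (E : pointedType) (x y : stepCS E) a :
  restr x a = restr y a <-> step_agree a x y.
Proof.
apply: agree_restrE; [exact: step_agree_refl|exact: step_agree_sym|].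
exact: step_agree_trans.
Qed.

(** Pointwise operations and relations on the common refinement. *)

Definition step_map (E F : Type) (f : E -> F) (x : step E) : step F :=
  step_of f (coef_partition x).

Lemma meet_partition (E F : Type) (x : step E) (y : step F) :
  is_partition (fun p : E * F => (x p.1 `&` y p.2)%O).
Proof. exact: (concat_partition (fun=> y) (coef_partition x)). Qed.

Definition step_map2 (E F G : Type) (f : E -> F -> G) (x : step E)
  (y : step F) : step G := step_of (fun p => f p.1 p.2) (meet_partition x y).

Lemma step_map_le (E F : Type) (f : E -> F) (x : step E) b u :
  (b <= x u)%O -> (b <= step_map f x (f u))%O.
Proof. exact: step_of_le. Qed.

Lemma step_map2_le (E F G : Type) (f : E -> F -> G) (x : step E)
  (y : step F) b u v :
  (b <= x u)%O -> (b <= y v)%O -> (b <= step_map2 f x y (f u v))%O.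
Proof.
move=> bu bv; apply: (@step_of_le _ _ (fun p => f p.1 p.2) _ _ _ (u, v)).
by rewrite /= lexI bu.
Qed.

Definition step_rel (E F : Type) (r : E -> F -> Prop) (x : step E)
  (y : step F) : Prop :=
  forall u v, (\bot < x u `&` y v)%O -> r u v.

Definition step_rel_on (a : A) (E F : Type) (r : E -> F -> Prop) (x : step E)
  (y : step F) : Prop :=
  forall u v, (\bot < x u `&` y v `&` a)%O -> r u v.

Lemma step_rel_onP a (E F : Type) (r : E -> F -> Prop)
  (x : step E) (y : step F) :
  step_rel_on a r x y <-> forall b u v, b <> \bot%O -> (b <= a)%O ->
    (b <= x u)%O -> (b <= y v)%O -> r u v.
Proof.
split=> [h b u v b0 ba bu bv|h u v /bot_lt b0].
  apply: h; apply/bot_lt; apply: contra_not b0 => h.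
  by apply/eqP; rewrite -lex0 -h !lexI bu bv.
apply: (h _ _ _ b0); first exact: leIr.
  by rewrite (le_trans (leIl _ _))// leIl.
by rewrite (le_trans (leIl _ _))// leIr.
Qed.

Lemma step_rel_on1 (E F : Type) (r : E -> F -> Prop)
  (x : step E) (y : step F) :
  step_rel_on \top%O r x y <-> step_rel r x y.
Proof.
split=> h u v; first by move=> uv; apply: h; rewrite meetx1.
by rewrite meetx1; exact: h.
Qed.

Lemma step_relE (E F : Type) (r : E -> F -> Prop)
  (x : step E) (y : step F) b u v :
  step_rel r x y -> b <> \bot%O -> (b <= x u)%O -> (b <= y v)%O -> r u v.
Proof.
move=> xy b0; have /step_rel_onP h := (step_rel_on1 r x y).2 xy.
by apply: h => //; exact: lex1.
Qed.

Lemma step_rel_on_intro a (E F : Type) (r : E -> F -> Prop)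
  (x : step E) (y : step F) :
  (forall b, b <> \bot%O -> (b <= a)%O -> exists c u v,
    [/\ c <> \bot%O, (c <= b)%O, (c <= x u)%O, (c <= y v)%O & r u v]) ->
  step_rel_on a r x y.
Proof.
move=> h; apply/step_rel_onP => b u v b0 ba bu bv.
have [c [u' [v' [c0 cb cu cv]]]] := h b b0 ba.
by rewrite (step_inj c0 (le_trans cb bu) cu) (step_inj c0 (le_trans cb bv) cv).
Qed.

Lemma step_rel_intro (E F : Type) (r : E -> F -> Prop)
  (x : step E) (y : step F) :
  (forall b, b <> \bot%O -> exists c u v,
    [/\ c <> \bot%O, (c <= b)%O, (c <= x u)%O, (c <= y v)%O & r u v]) ->
  step_rel r x y.
Proof.
move=> h; apply: (step_rel_on1 r x y).1.
by apply: step_rel_on_intro => b b0 _; exact: h.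
Qed.

End Steps.

(** * Conditional sequences and the conditional completion *)

(* From [b0 : b <> \bot], decide the value [u] of [x] on some smaller nonzero
   condition [c], to which all hypotheses [b <= _] are transported. *)
Ltac step_decide x u :=
  match goal with b0 : ?b <> \bot%O |- _ =>
    let c' := fresh "c" in let cb := fresh "cb" in
    let c0' := fresh "c0" in let cu := fresh "L" u in
    destruct (step_pick x b0) as (c' & u & [c0' cb cu]);
    repeat match goal with H : is_true (b <= _)%O |- _ =>
      apply (le_trans cb) in H end;
    clear b0 cb; try clear b; try rename c' into c; try rename c0' into c0
  end.

Section Sequences.
Context {d : Order.disp_t} {A : cbaType d}.
Implicit Types (m n p : step A nat).

Record cond_seq (Z : condSet A) := CondSeq {
  cond_seq_fun :> stepCS A nat -> Z;
  cond_seq_stable : stable cond_seq_fun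
}.

Definition le_step_nat : step A nat -> step A nat -> Prop :=
  step_rel (fun i j => (i <= j)%N).

(* This is the order inherited from $\mathbb{R}_s$. *)
Lemma le_step_natE (R : realType) m n : le_step_nat m n <->
  step_rel (fun s t : R => s <= t) (step_map (fun i => i%:R) m)
    (step_map (fun i => i%:R) n).
Proof.
split=> mn; apply: step_rel_intro => b b0; have bb := lexx b;
    step_decide m u; step_decide n v.
  exists c, u%:R, v%:R; split=> //; last 1 first.
  - by rewrite ler_nat; exact: step_relE mn c0 _ _.
  - exact: (@step_map_le _ _ _ _ (fun i => i%:R)).
  - exact: (@step_map_le _ _ _ _ (fun i => i%:R)).
exists c, u, v; split=> //; rewrite -(ler_nat R).
by apply: (step_relE mn c0); exact: (@step_map_le _ _ _ _ (fun i => i%:R)).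
Qed.

Lemma le_step_nat_refl n : le_step_nat n n.
Proof.
apply: step_rel_intro => b b0; have bb := lexx b.
by step_decide n u; exists c, u, u.
Qed.

Lemma le_step_nat_trans m n p :
  le_step_nat m n -> le_step_nat n p -> le_step_nat m p.
Proof.
move=> mn np; apply: step_rel_intro => b b0; have bb := lexx b.
step_decide m u; step_decide n v; step_decide p w; exists c, u, w; split=> //.
apply: (@leq_trans v); first exact: step_relE mn c0 _ _.
exact: step_relE np c0 _ _.
Qed.

Lemma le_step_nat_max m n : le_step_nat m (step_map2 maxn m n) /\
  le_step_nat n (step_map2 maxn m n).
Proof.
split; apply: step_rel_intro => b b0; have bb := lexx b.
  step_decide m u; step_decide n v; exists c, u, (maxn u v).
  by split=> //; [exact: step_map2_le|exact: leq_maxl].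
step_decide m u; step_decide n v; exists c, v, (maxn u v).
by split=> //; [exact: step_map2_le|exact: leq_maxr].
Qed.

Lemma step_max_agree a m n : step_rel_on a (fun i j => (j <= i)%N) m n ->
  step_agree a (step_map2 maxn m n) m.
Proof.
move=> /step_rel_onP mn; apply: step_agree_intro => b b0 ba.
have bb := lexx b; step_decide m u; step_decide n v; exists c, u; split=> //.
by have := step_map2_le maxn Lu Lv; rewrite (maxn_idPl (mn _ _ _ c0 ba Lu Lv)).
Qed.


Lemma cond_seq_agree (E : pointedType) (x : cond_seq (stepCS A E)) a m n :
  step_agree a m n -> step_agree a (x m) (x n).
Proof.
move=> /(stepCS_restr (m : stepCS A nat))/((stable_restr _).1 (@cond_seq_stable _ x)).
by move/stepCS_restr.
Qed.

Lemma agree_cond_seq (E : pointedType) (x : step A nat -> step A E) :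
  (forall a m n, step_agree a m n -> step_agree a (x m) (x n)) ->
  @stable _ _ (stepCS A nat) (stepCS A E) x.
Proof.
move=> h; apply/stable_restr => m n a /stepCS_restr mn.
by apply/stepCS_restr; exact: h.
Qed.

End Sequences.

Section StepAgreeMaps.
Context {d : Order.disp_t} {A : cbaType d}.

Lemma step_map_agree (E F : Type) (f : E -> F) a (x y : step A E) :
  step_agree a x y -> step_agree a (step_map f x) (step_map f y).
Proof.
move=> /step_agreeP xy; apply: step_agree_intro => b b0 ba; have bb := lexx b.
step_decide x u; step_decide y v; exists c, (f u); split=> //.
  exact: step_map_le.
by rewrite (xy _ _ _ c0 ba Lu Lv); exact: step_map_le.
Qed.

Lemma step_map2_agree (E F G : Type) (f : E -> F -> G) a (x x' : step A E)
  (y y' : step A F) : step_agree a x x' -> step_agree a y y' ->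
  step_agree a (step_map2 f x y) (step_map2 f x' y').
Proof.
move=> /step_agreeP xx /step_agreeP yy; apply: step_agree_intro => b b0 ba.
have bb := lexx b; step_decide x u; step_decide x' u'.
step_decide y v; step_decide y' v'; exists c, (f u v); split=> //.
  exact: step_map2_le.
rewrite (xx _ _ _ c0 ba Lu Lu') (yy _ _ _ c0 ba Lv Lv').
exact: step_map2_le.
Qed.

Lemma step_rel_on_agree (E F : Type) (r : E -> F -> Prop) a (x x' : step A E)
  (y : step A F) : step_agree a x x' ->
  step_rel_on a r x y -> step_rel_on a r x' y.
Proof.
move=> /step_agreeP xx /step_rel_onP xy; apply: step_rel_on_intro => b b0 ba.
have bb := lexx b; step_decide x u; step_decide x' u'; step_decide y v.
exists c, u', v; split=> //; rewrite -(xx _ _ _ c0 ba Lu Lu').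
exact: xy c0 _ _ _.
Qed.

Lemma step_rel_sub a (E F : Type) (r : E -> F -> Prop) (x : step A E)
  (y : step A F) : step_rel r x y -> step_rel_on a r x y.
Proof.
move=> xy; apply: step_rel_on_intro => b b0 ba; have bb := lexx b.
step_decide x u; step_decide y v; exists c, u, v; split=> //.
exact: step_relE xy c0 _ _.
Qed.

End StepAgreeMaps.

(* Step functions with values in a normed space, and in the reals. *)
Section StepNorm.
Context {d : Order.disp_t} {A : cbaType d} {R : realType}.
Variable X : normedModType R.

Definition step_norm : step A X -> step A R := step_map (fun u => `|u|).

Definition step_sub : step A X -> step A X -> step A X :=
  step_map2 (fun u v => u - v).

Definition lt_step : step A R -> step A R -> Prop := step_rel (fun s t => s < t).

Definition lt_step_on (a : A) : step A R -> step A R -> Prop :=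
  step_rel_on a (fun s t => s < t).

Definition step_pos (r : step A R) : Prop := lt_step (step_cst A 0) r.

Lemma step_posE (r : step A R) b t : step_pos r -> b <> \bot%O -> (b <= r t)%O -> 0 < t.
Proof. by move=> r0 b0 bt; apply: (step_relE r0 b0 _ bt); exact: step_cst_le. Qed.

Lemma step_pos_intro (r : step A R) :
  (forall b, b <> \bot%O -> exists c t,
    [/\ c <> \bot%O, (c <= b)%O, (c <= r t)%O & 0 < t]) -> step_pos r.
Proof.
move=> h; apply: step_rel_intro => b /h[c [t [c0 cb ct t0]]].
by exists c, 0, t; split=> //; exact: step_cst_le.
Qed.

Lemma step_norm_sub_le b (x y : step A X) u v : (b <= x u)%O -> (b <= y v)%O ->
  (b <= step_norm (step_sub x y) `|u - v|)%O.
Proof.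
by move=> bu bv; apply: (@step_map_le _ _ _ _ (fun u : X => `|u|));
  apply: (@step_map2_le _ _ _ _ _ (fun u v : X => u - v)).
Qed.

Lemma step_halfP (r : step A R) : step_pos r -> step_pos (step_map (fun t => t / 2) r).
Proof.
move=> r0; apply: step_pos_intro => b b0; have bb := lexx b.
step_decide r t; exists c, (t / 2); split=> //.
  exact: (@step_map_le _ _ _ _ (fun t => t / 2)).
by rewrite divr_gt0//; exact: step_posE Lt.
Qed.

Definition is_cauchy (x : cond_seq (stepCS A X)) : Prop :=
  forall r : step A R, step_pos r -> exists n0 : step A nat,
    forall m n, le_step_nat n0 m -> le_step_nat n0 n ->
      lt_step (step_norm (step_sub (x m) (x n))) r.

Record cauchy_seq := CauchySeq {
  cauchy_cond_seq :> cond_seq (stepCS A X);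
  cauchyP : is_cauchy cauchy_cond_seq
}.

(* $\|x_n-y_n\|$ converges to 0 on [a]. *)
Definition cauchy_agree (a : A) (x y : cauchy_seq) : Prop :=
  forall r : step A R, step_pos r -> exists n0 : step A nat,
    forall n, le_step_nat n0 n ->
      lt_step_on a (step_norm (step_sub (x n) (y n))) r.

Lemma cauchy_agree_refl a x : cauchy_agree a x x.
Proof.
move=> r r0; exists (step_cst A 0%N) => n _.
apply: step_rel_on_intro => b b0 ba; have bb := lexx b.
step_decide (x n) u; step_decide r t; exists c, `|u - u|, t.
by split=> //; [exact: step_norm_sub_le|rewrite subrr normr0; exact: step_posE Lt].
Qed.

Lemma cauchy_agree_sym a x y : cauchy_agree a x y -> cauchy_agree a y x.
Proof.
move=> xy r r0; have [n0 n0P] := xy r r0; exists n0 => n n0n.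
have /step_rel_onP h := n0P n n0n.
apply: step_rel_on_intro => b b0 ba; have bb := lexx b.
step_decide (x n) u; step_decide (y n) v; step_decide r t.
exists c, `|v - u|, t; split=> //; first exact: step_norm_sub_le.
by rewrite distrC; apply: h c0 _ _ _ => //; exact: step_norm_sub_le.
Qed.

Lemma cauchy_agree_trans a x y z :
  cauchy_agree a x y -> cauchy_agree a y z -> cauchy_agree a x z.
Proof.
move=> xy yz r /[dup] r0 /step_halfP rh.
have [n1 n1P] := xy _ rh; have [n2 n2P] := yz _ rh.
have [m1 m2] := le_step_nat_max n1 n2; exists (step_map2 maxn n1 n2) => n nP.
have /step_rel_onP h1 := n1P _ (le_step_nat_trans m1 nP).
have /step_rel_onP h2 := n2P _ (le_step_nat_trans m2 nP).
apply: step_rel_on_intro => b b0 ba; have bb := lexx b.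
step_decide (x n) u; step_decide (y n) v; step_decide (z n) w; step_decide r t.
have Lt2 := @step_map_le _ _ _ _ (fun t => t / 2) _ _ _ Lt.
exists c, `|u - w|, t; split=> //; first exact: step_norm_sub_le.
rewrite (splitr t) (le_lt_trans (ler_distD v _ _))// ltrD//.
  by apply: h1 c0 _ _ Lt2 => //; exact: step_norm_sub_le.
by apply: h2 c0 _ _ Lt2 => //; exact: step_norm_sub_le.
Qed.

Lemma cauchy_agree_mono a b x y :
  cauchy_agree b x y -> (a <= b)%O -> cauchy_agree a x y.
Proof.
move=> xy ab r r0; have [n0 n0P] := xy r r0; exists n0 => n /n0P/step_rel_onP h.
apply/step_rel_onP => c u v c0 ca; apply: h => //; exact: le_trans ca ab.
Qed.

(* Concatenation of Cauchy sequences. *)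
Section Concat.
Variables (I : Type) (a : I -> A) (pa : is_partition a) (x_ : I -> cauchy_seq).

Let cfun (n : step A nat) : step A X := step_concat pa (fun i => x_ i n).

Lemma cauchy_concat_stable : @stable _ _ (stepCS A nat) (stepCS A X) cfun.
Proof.
apply: agree_cond_seq => b m n mn; apply: step_agree_intro => b' b0 b'b.
have [i bi] := partition_pick pa b0.
have [bb ca] : (b' `&` a i <= b')%O /\ (b' `&` a i <= a i)%O.
  by split; [exact: leIl|exact: leIr].
have := le_trans bb b'b; move: (b' `&` a i)%O bi bb ca => e e0 bb ca eb.
have /step_agreeP h1 := step_concatP pa (fun i => x_ i m) i.
have /step_agreeP h2 := step_concatP pa (fun i => x_ i n) i.
have /step_agreeP h := cond_seq_agree (x_ i) mn.
step_decide (cfun m) u; step_decide (cfun n) v.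
step_decide (x_ i m) u'; step_decide (x_ i n) v'.
exists c, u; split=> //.
rewrite (h1 _ _ _ c0 ca Lu Lu') (h _ _ _ c0 eb Lu' Lv').
by rewrite -(h2 _ _ _ c0 ca Lv Lv').
Qed.

Lemma cauchy_concat_cauchy : is_cauchy (CondSeq cauchy_concat_stable).
Proof.
move=> r r0; have /choice[n_ n_P] i := cauchyP (x_ i) r0.
exists (step_concat pa n_) => m n mP nP; apply: step_rel_intro => b b0.
have [i bi] := partition_pick pa b0.
have [bb ba] : (b `&` a i <= b)%O /\ (b `&` a i <= a i)%O.
  by split; [exact: leIl|exact: leIr].
move: (b `&` a i)%O bi bb ba => e e0 bb ba.
have later p : le_step_nat (step_concat pa n_) p ->
    step_agree (a i) (cfun p) (x_ i (step_map2 maxn p (n_ i))).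
  move=> pP; apply: (step_agree_trans (step_concatP _ _ i)).
  apply/step_agree_sym/cond_seq_agree/step_max_agree.
  have /step_agreeP h := step_concatP pa n_ i.
  apply: step_rel_on_intro => {b b0 bb}b b0 ba'; have bb := lexx b.
  step_decide p u; step_decide (n_ i) v; step_decide (step_concat pa n_) w.
  exists c, u, v; split=> //; rewrite -(h _ _ _ c0 ba' Lw Lv).
  exact: step_relE pP c0 Lw Lu.
have /step_agreeP hm := later _ mP; have /step_agreeP hn := later _ nP.
have hr := n_P i _ _ (le_step_nat_max m (n_ i)).2 (le_step_nat_max n (n_ i)).2.
step_decide (cfun m) u; step_decide (cfun n) v; step_decide r t.
step_decide (x_ i (step_map2 maxn m (n_ i))) u'.
step_decide (x_ i (step_map2 maxn n (n_ i))) v'.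
exists c, `|u - v|, t; split=> //; first exact: step_norm_sub_le.
rewrite (hm _ _ _ c0 ba Lu Lu') (hn _ _ _ c0 ba Lv Lv').
by apply: (step_relE hr c0 _ Lt); exact: step_norm_sub_le.
Qed.

Definition cauchy_concat : cauchy_seq := CauchySeq cauchy_concat_cauchy.

Lemma cauchy_concatP i : cauchy_agree (a i) cauchy_concat (x_ i).
Proof.
move=> r r0; exists (step_cst A 0%N) => n _.
have /step_agreeP h := step_concatP pa (fun i => x_ i n) i.
apply: step_rel_on_intro => b b0 ba; have bb := lexx b.
step_decide (cfun n) u; step_decide (x_ i n) v; step_decide r t.
exists c, `|u - v|, t; split=> //; first exact: step_norm_sub_le.
by rewrite (h _ _ _ c0 ba Lu Lv) subrr normr0; exact: step_posE Lt.
Qed.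

(* Agreement is local. *)
Lemma cauchy_agree_local b x y :
  (forall i, cauchy_agree (a i) x y) -> cauchy_agree b x y.
Proof.
move=> xy r r0; have /choice[n_ n_P] i := xy i r r0.
exists (step_concat pa n_) => n nP; apply: step_rel_on_intro => b' b0 _.
have [i bi] := partition_pick pa b0.
have [bb ba] : (b' `&` a i <= b')%O /\ (b' `&` a i <= a i)%O.
  by split; [exact: leIl|exact: leIr].
move: (b' `&` a i)%O bi bb ba => e e0 bb ba.
have mx : step_agree (a i) (step_map2 maxn n (n_ i)) n.
  apply: step_max_agree; have /step_agreeP h := step_concatP pa n_ i.
  apply: step_rel_on_intro => {b' b0 bb}b b0 ba'; have bb := lexx b.
  step_decide n u; step_decide (n_ i) v; step_decide (step_concat pa n_) w.
  exists c, u, v; split=> //; rewrite -(h _ _ _ c0 ba' Lw Lv).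
  exact: step_relE nP c0 Lw Lu.
have /step_agreeP hx := cond_seq_agree x mx.
have /step_agreeP hy := cond_seq_agree y mx.
have /step_rel_onP hr := n_P i _ (le_step_nat_max n (n_ i)).2.
step_decide (x n) u; step_decide (y n) v; step_decide r t.
step_decide (x (step_map2 maxn n (n_ i))) u'.
step_decide (y (step_map2 maxn n (n_ i))) v'.
exists c, `|u - v|, t; split=> //; first exact: step_norm_sub_le.
rewrite -(hx _ _ _ c0 ba Lu' Lu) -(hy _ _ _ c0 ba Lv' Lv).
by apply: (hr _ _ _ c0 ba _ Lt); exact: step_norm_sub_le.
Qed.

End Concat.

HB.instance Definition _ := gen_eqMixin cauchy_seq.
HB.instance Definition _ := gen_choiceMixin cauchy_seq.

Definition cauchy_eq : rel cauchy_seq := fun x y => `[< cauchy_agree \top%O x y >].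

Lemma cauchy_eq_refl : reflexive cauchy_eq.
Proof. by move=> x; apply/asboolP; exact: cauchy_agree_refl. Qed.

Lemma cauchy_eq_sym : symmetric cauchy_eq.
Proof.
by move=> x y; apply/asboolP/asboolP => /cauchy_agree_sym.
Qed.

Lemma cauchy_eq_trans : transitive cauchy_eq.
Proof.
move=> y x z /asboolP xy /asboolP yz; apply/asboolP.
exact: cauchy_agree_trans yz.
Qed.

Canonical cauchy_equiv :=
  EquivRel cauchy_eq cauchy_eq_refl cauchy_eq_sym cauchy_eq_trans.

End StepNorm.
Arguments cauchy_seq {d} A {R} X.

(* Representative-wise operations on conditional Cauchy sequences. *)
Section CauchyOperations.
Context {d : Order.disp_t} {A : cbaType d} {R : realType}.
Implicit Types (X : normedModType R) (a : A).

Lemma cst_seq_stable X (e : step A X) :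
  @stable _ _ (stepCS A nat) (stepCS A X) (fun=> e).
Proof. by apply: agree_cond_seq. Qed.

Lemma cst_seq_cauchy X (e : step A X) : is_cauchy (CondSeq (cst_seq_stable e)).
Proof.
move=> r r0; exists (step_cst A 0%N) => m n _ _.
apply: step_rel_intro => b b0; have bb := lexx b.
step_decide e u; step_decide r t; exists c, `|u - u|, t; split=> //.
  exact: step_norm_sub_le.
by rewrite subrr normr0; exact: step_posE Lt.
Qed.

Definition cauchy_cst X (e : step A X) : cauchy_seq A X :=
  CauchySeq (cst_seq_cauchy e).

Lemma add_seq_stable X (x y : cauchy_seq A X) :
  @stable _ _ (stepCS A nat) (stepCS A X)
    (fun n => step_map2 (fun u v => u + v) (x n) (y n)).
Proof.
by apply: agree_cond_seq => a m n mn; apply: step_map2_agree;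
  exact: cond_seq_agree.
Qed.

Lemma add_seq_cauchy X (x y : cauchy_seq A X) :
  is_cauchy (CondSeq (add_seq_stable x y)).
Proof.
move=> r /step_halfP rh.
have [n1 n1P] := cauchyP x rh; have [n2 n2P] := cauchyP y rh.
have [m1 m2] := le_step_nat_max n1 n2.
exists (step_map2 maxn n1 n2) => m n mP nP.
have h1 := n1P _ _ (le_step_nat_trans m1 mP) (le_step_nat_trans m1 nP).
have h2 := n2P _ _ (le_step_nat_trans m2 mP) (le_step_nat_trans m2 nP).
apply: step_rel_intro => b b0; have bb := lexx b.
step_decide (x m) u; step_decide (y m) v; step_decide r t.
step_decide (x n) u'; step_decide (y n) v'.
have Lt2 := @step_map_le _ _ _ _ (fun t => t / 2) _ _ _ Lt.
exists c, `|(u + v) - (u' + v')|, t; split=> //.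
  by apply: step_norm_sub_le;
    exact: (@step_map2_le _ _ _ _ _ (fun u v : X => u + v)).
rewrite opprD addrACA (splitr t) (le_lt_trans (ler_normD _ _))// ltrD//.
  by apply: (step_relE h1 c0 _ Lt2); exact: step_norm_sub_le.
by apply: (step_relE h2 c0 _ Lt2); exact: step_norm_sub_le.
Qed.

Definition cauchy_add X (x y : cauchy_seq A X) : cauchy_seq A X :=
  CauchySeq (add_seq_cauchy x y).

Lemma cauchy_add_agree X a (x x' y y' : cauchy_seq A X) :
  cauchy_agree a x x' -> cauchy_agree a y y' ->
  cauchy_agree a (cauchy_add x y) (cauchy_add x' y').
Proof.
move=> xx yy r /step_halfP rh.
have [n1 n1P] := xx _ rh; have [n2 n2P] := yy _ rh.
have [m1 m2] := le_step_nat_max n1 n2.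
exists (step_map2 maxn n1 n2) => n nP.
have /step_rel_onP h1 := n1P _ (le_step_nat_trans m1 nP).
have /step_rel_onP h2 := n2P _ (le_step_nat_trans m2 nP).
apply: step_rel_on_intro => b b0 ba; have bb := lexx b.
step_decide (x n) u; step_decide (y n) v; step_decide r t.
step_decide (x' n) u'; step_decide (y' n) v'.
have Lt2 := @step_map_le _ _ _ _ (fun t => t / 2) _ _ _ Lt.
exists c, `|(u + v) - (u' + v')|, t; split=> //.
  by apply: step_norm_sub_le;
    exact: (@step_map2_le _ _ _ _ _ (fun u v : X => u + v)).
rewrite opprD addrACA (splitr t) (le_lt_trans (ler_normD _ _))// ltrD//.
  by apply: h1 c0 _ _ Lt2 => //; exact: step_norm_sub_le.
by apply: h2 c0 _ _ Lt2 => //; exact: step_norm_sub_le.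
Qed.

Lemma norm_seq_stable X (x : cauchy_seq A X) :
  @stable _ _ (stepCS A nat) (stepCS A R^o) (fun n => step_norm (x n)).
Proof.
by apply: agree_cond_seq => a m n mn; apply: step_map_agree;
  exact: cond_seq_agree.
Qed.

Lemma norm_seq_cauchy X (x : cauchy_seq A X) :
  is_cauchy (CondSeq (norm_seq_stable x)).
Proof.
move=> r r0; have [n0 n0P] := cauchyP x r0; exists n0 => m n /n0P mP /mP h.
apply: step_rel_intro => b b0; have bb := lexx b.
step_decide (x m) u; step_decide (x n) v; step_decide r t.
exists c, `| `|u| - `|v| |, t; split=> //.
  by apply: (@step_norm_sub_le _ _ _ R^o);
    exact: (@step_map_le _ _ _ _ (fun u : X => `|u|)).
apply: (le_lt_trans (ler_dist_dist _ _)).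
by apply: (step_relE h c0 _ Lt); exact: step_norm_sub_le.
Qed.

Definition cauchy_norm X (x : cauchy_seq A X) : cauchy_seq A R^o :=
  CauchySeq (norm_seq_cauchy x).

Lemma cauchy_norm_agree X a (x x' : cauchy_seq A X) : cauchy_agree a x x' ->
  cauchy_agree a (cauchy_norm x) (cauchy_norm x').
Proof.
move=> xx r r0; have [n0 n0P] := xx _ r0; exists n0 => n /n0P/step_rel_onP h.
apply: step_rel_on_intro => b b0 ba; have bb := lexx b.
step_decide (x n) u; step_decide (x' n) v; step_decide r t.
exists c, `| `|u| - `|v| |, t; split=> //.
  by apply: (@step_norm_sub_le _ _ _ R^o);
    exact: (@step_map_le _ _ _ _ (fun u : X => `|u|)).
apply: (le_lt_trans (ler_dist_dist _ _)).
by apply: h c0 _ _ Lt => //; exact: step_norm_sub_le.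
Qed.

Lemma cauchy_bounded X (x : cauchy_seq A X) : exists (M : step A R) n0,
  forall n, le_step_nat n0 n -> lt_step (step_norm (x n)) M.
Proof.
have p1 : step_pos (step_cst A (1 : R)).
  apply: step_pos_intro => b b0; exists b, 1.
  by split=> //; exact: step_cst_le.
have [n0 n0P] := cauchyP x p1.
exists (step_map (fun u => `|u| + 1) (x n0)), n0 => n nP.
have h := n0P _ _ nP (@le_step_nat_refl _ _ n0).
apply: step_rel_intro => b b0; have bb := lexx b.
step_decide (x n) u; step_decide (x n0) v.
exists c, `|u|, (`|v| + 1); split=> //.
- exact: (@step_map_le _ _ _ _ (fun u : X => `|u|)).
- exact: (@step_map_le _ _ _ _ (fun u : X => `|u| + 1)).
rewrite -ltrBlDl -(normrN v) (le_lt_trans (lerB_normD _ _))//.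
apply: (step_relE h c0 _ (step_cst_le _ _)).
exact: step_norm_sub_le.
Qed.

Definition step_ratio (r M : step A R) : step A R :=
  step_map2 (fun t s => t / (2 * (`|s| + 1))) r M.

Lemma step_ratio_pos r M : step_pos r -> step_pos (step_ratio r M).
Proof.
move=> r0; apply: step_pos_intro => b b0; have bb := lexx b.
step_decide r t; step_decide M s; exists c, (t / (2 * (`|s| + 1))).
split=> //; first exact: (@step_map2_le _ _ _ _ _ (fun t s => t / (2 * (`|s| + 1)))).
apply: divr_gt0; first exact: step_posE Lt.
by rewrite mulr_gt0// ltr_pwDr.
Qed.

Lemma scale_dist X (k k' t s1 s2 : R) (u u' : X) :
  `|k| < s1 -> `|u'| < s2 -> 0 < t ->
  `|k - k'| < t / (2 * (`|s2| + 1)) -> `|u - u'| < t / (2 * (`|s1| + 1)) ->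
  `|k *: u - k' *: u'| < t.
Proof.
move=> ks us t0 kk uu.
have -> : k *: u - k' *: u' = k *: (u - u') + (k - k') *: u'.
  by rewrite scalerBr scalerBl addrA subrK.
rewrite (le_lt_trans (ler_normD _ _))// !normrZ (splitr t) ltrD//.
  have s1p : 0 < `|s1| + 1 by rewrite ltr_pwDr.
  rewrite (@le_lt_trans _ _ ((`|s1| + 1) * `|u - u'|))//.
    by rewrite ler_wpM2r// ltW// (lt_le_trans ks)// (le_trans (ler_norm _))// lerDl.
  by rewrite -ltr_pdivlMl// mulrC (lt_le_trans uu)// invfM mulrA.
have s2p : 0 < `|s2| + 1 by rewrite ltr_pwDr.
rewrite (@le_lt_trans _ _ (`|k - k'| * (`|s2| + 1)))//.
  by rewrite ler_wpM2l// ltW// (lt_le_trans us)// (le_trans (ler_norm _))// lerDl.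
by rewrite -ltr_pdivlMr// (lt_le_trans kk)// invfM mulrA.
Qed.

Lemma scale_seq_stable X (k : cauchy_seq A R^o) (x : cauchy_seq A X) :
  @stable _ _ (stepCS A nat) (stepCS A X)
    (fun n => step_map2 (fun (s : R) (u : X) => s *: u) (k n) (x n)).
Proof.
by apply: agree_cond_seq => a m n mn; apply: step_map2_agree;
  exact: cond_seq_agree.
Qed.

Lemma scale_seq_cauchy X (k : cauchy_seq A R^o) (x : cauchy_seq A X) :
  is_cauchy (CondSeq (scale_seq_stable k x)).
Proof.
move=> r r0.
have [M1 [p1 p1P]] := cauchy_bounded k; have [M2 [p2 p2P]] := cauchy_bounded x.
have [n1 n1P] := cauchyP k (@step_ratio_pos _ M2 r0).
have [n2 n2P] := cauchyP x (@step_ratio_pos _ M1 r0).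
have [m1 m2] := le_step_nat_max n1 n2; have [q1 q2] := le_step_nat_max p1 p2.
set n' := step_map2 maxn n1 n2 in m1 m2; set p' := step_map2 maxn p1 p2 in q1 q2.
have [nn pp] := le_step_nat_max n' p'.
exists (step_map2 maxn n' p') => m n mP nP.
have [mn np] := (le_step_nat_trans nn mP, le_step_nat_trans nn nP).
have h1 := n1P _ _ (le_step_nat_trans m1 mn) (le_step_nat_trans m1 np).
have h2 := n2P _ _ (le_step_nat_trans m2 mn) (le_step_nat_trans m2 np).
have b1 := p1P _ (le_step_nat_trans q1 (le_step_nat_trans pp mP)).
have b2 := p2P _ (le_step_nat_trans q2 (le_step_nat_trans pp nP)).
apply: step_rel_intro => b b0; have bb := lexx b.
step_decide (k m) s; step_decide (k n) s'; step_decide (x m) u.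
step_decide (x n) u'; step_decide r t; step_decide M1 y; step_decide M2 z.
exists c, `|s *: u - s' *: u'|, t; split=> //.
  by apply: step_norm_sub_le;
    exact: (@step_map2_le _ _ _ _ _ (fun (s : R) (u : X) => s *: u)).
apply: (@scale_dist _ _ _ _ y z).
- by apply: (step_relE b1 c0 _ Ly); exact: (@step_map_le _ _ _ _ (fun u : R => `|u|)).
- by apply: (step_relE b2 c0 _ Lz); exact: (@step_map_le _ _ _ _ (fun u : X => `|u|)).
- exact: step_posE Lt.
- apply: (step_relE h1 c0); first exact: (@step_norm_sub_le _ _ _ R^o).
  exact: (@step_map2_le _ _ _ _ _ (fun t s => t / (2 * (`|s| + 1)))).
- apply: (step_relE h2 c0); first exact: step_norm_sub_le.
  exact: (@step_map2_le _ _ _ _ _ (fun t s => t / (2 * (`|s| + 1)))).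
Qed.

Definition cauchy_scale X (k : cauchy_seq A R^o) (x : cauchy_seq A X) :
  cauchy_seq A X := CauchySeq (scale_seq_cauchy k x).

Lemma cauchy_scale_agree X a (k k' : cauchy_seq A R^o) (x x' : cauchy_seq A X) :
  cauchy_agree a k k' -> cauchy_agree a x x' ->
  cauchy_agree a (cauchy_scale k x) (cauchy_scale k' x').
Proof.
move=> kk xx r r0.
have [M1 [p1 p1P]] := cauchy_bounded k; have [M2 [p2 p2P]] := cauchy_bounded x'.
have [n1 n1P] := kk _ (@step_ratio_pos _ M2 r0).
have [n2 n2P] := xx _ (@step_ratio_pos _ M1 r0).
have [m1 m2] := le_step_nat_max n1 n2; have [q1 q2] := le_step_nat_max p1 p2.
set n' := step_map2 maxn n1 n2 in m1 m2; set p' := step_map2 maxn p1 p2 in q1 q2.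
have [nn pp] := le_step_nat_max n' p'.
exists (step_map2 maxn n' p') => n nP.
have np := le_step_nat_trans nn nP; have pn := le_step_nat_trans pp nP.
have /step_rel_onP h1 := n1P _ (le_step_nat_trans m1 np).
have /step_rel_onP h2 := n2P _ (le_step_nat_trans m2 np).
have b1 := p1P _ (le_step_nat_trans q1 pn).
have b2 := p2P _ (le_step_nat_trans q2 pn).
apply: step_rel_on_intro => b b0 ba; have bb := lexx b.
step_decide (k n) s; step_decide (k' n) s'; step_decide (x n) u.
step_decide (x' n) u'; step_decide r t; step_decide M1 y; step_decide M2 z.
exists c, `|s *: u - s' *: u'|, t; split=> //.
  by apply: step_norm_sub_le;
    exact: (@step_map2_le _ _ _ _ _ (fun (s : R) (u : X) => s *: u)).
apply: (@scale_dist _ _ _ _ y z).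
- by apply: (step_relE b1 c0 _ Ly); exact: (@step_map_le _ _ _ _ (fun u : R => `|u|)).
- by apply: (step_relE b2 c0 _ Lz); exact: (@step_map_le _ _ _ _ (fun u : X => `|u|)).
- exact: step_posE Lt.
- apply: (h1 _ _ _ c0) => //; first exact: (@step_norm_sub_le _ _ _ R^o).
  exact: (@step_map2_le _ _ _ _ _ (fun t s => t / (2 * (`|s| + 1)))).
- apply: (h2 _ _ _ c0) => //; first exact: step_norm_sub_le.
  exact: (@step_map2_le _ _ _ _ _ (fun t s => t / (2 * (`|s| + 1)))).
Qed.

(* $y_m-x_m>-r$ eventually, for every $r>0$. *)
Definition cauchy_le (x y : cauchy_seq A R^o) : Prop :=
  forall r : step A R, step_pos r -> exists n, forall m, le_step_nat n m ->
    lt_step (step_map (fun t => - t) r) (step_sub (y m) (x m)).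

Lemma cauchy_le_agree x x' y y' : cauchy_agree \top%O x x' ->
  cauchy_agree \top%O y y' -> cauchy_le x y -> cauchy_le x' y'.
Proof.
move=> xx yy xy r /[dup] r0 /step_halfP rh.
have [n1 n1P] := xx _ (step_halfP rh); have [n2 n2P] := yy _ (step_halfP rh).
have [n3 n3P] := xy _ rh.
have [m1 m2] := le_step_nat_max n1 n2; set n' := step_map2 maxn n1 n2 in m1 m2.
have [nn pp] := le_step_nat_max n' n3.
exists (step_map2 maxn n' n3) => n nP.
have /step_rel_onP h1 := n1P _ (le_step_nat_trans m1 (le_step_nat_trans nn nP)).
have /step_rel_onP h2 := n2P _ (le_step_nat_trans m2 (le_step_nat_trans nn nP)).
have h3 := n3P _ (le_step_nat_trans pp nP).
apply: step_rel_intro => b b0; have bb := lexx b.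
step_decide (x n) u; step_decide (y n) v; step_decide r t.
step_decide (x' n) u'; step_decide (y' n) v'.
have Lt2 := @step_map_le _ _ _ _ (fun t => t / 2) _ _ _ Lt.
have Lt4 := @step_map_le _ _ _ _ (fun t => t / 2) _ _ _ Lt2.
exists c, (- t), (v' - u'); split=> //.
- exact: (@step_map_le _ _ _ _ (fun t => - t)).
- exact: (@step_map2_le _ _ _ _ _ (fun u v : R => u - v)).
have := h1 _ _ _ c0 (lex1 _) (@step_norm_sub_le _ _ _ R^o _ _ _ _ _ Lu Lu') Lt4.
have := h2 _ _ _ c0 (lex1 _) (@step_norm_sub_le _ _ _ R^o _ _ _ _ _ Lv Lv') Lt4.
have := step_relE h3 c0 (@step_map_le _ _ _ _ (fun t => - t) _ _ _ Lt2)
  (@step_map2_le _ _ _ _ _ (fun u v : R => u - v) _ _ _ _ _ Lv Lu).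
rewrite !ltr_norml; lra.
Qed.

End CauchyOperations.

(** * The conditional completion $X_c$ *)

Definition completion_of {d : Order.disp_t} (A : cbaType d) {R : realType}
  (X : normedModType R) : Type := {eq_quot (@cauchy_eq d A R X)}%qT.

Section Completion.
Context {d : Order.disp_t} {A : cbaType d} {R : realType}.
Implicit Types (X : normedModType R) (a : A).

Definition class X (x : cauchy_seq A X) : completion_of A X :=
  \pi_({eq_quot (@cauchy_eq d A R X)})%qT x.

Definition rep X (x : completion_of A X) : cauchy_seq A X :=
  repr (x : {eq_quot (@cauchy_eq d A R X)}%qT).

Lemma repK X (x : completion_of A X) : class (rep x) = x.
Proof. exact: reprK. Qed.

Lemma class_eq X (x y : cauchy_seq A X) :
  class x = class y <-> cauchy_agree \top%O x y.
Proof. by split=> [/eqquotP/asboolP|h]; last by apply/eqquotP/asboolP. Qed.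

Lemma class_rep X a (x : cauchy_seq A X) : cauchy_agree a (rep (class x)) x.
Proof.
by apply: cauchy_agree_mono (lex1 a); apply/class_eq; exact: repK.
Qed.

Definition completion_agree X a (x y : completion_of A X) : Prop :=
  cauchy_agree a (rep x) (rep y).

Lemma completion_agreeP X a (x y : cauchy_seq A X) :
  completion_agree a (class x) (class y) <-> cauchy_agree a x y.
Proof.
split=> h.
  apply: cauchy_agree_trans (class_rep a y).
  exact: cauchy_agree_trans (cauchy_agree_sym (class_rep a x)) h.
apply: cauchy_agree_trans (cauchy_agree_sym (class_rep a y)).
exact: cauchy_agree_trans (class_rep a x) h.
Qed.

Lemma completion_C3 X (I : Type) (a : I -> A) (x_ : I -> completion_of A X) :
  is_partition a -> exists! x, forall i, completion_agree (a i) x (x_ i).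
Proof.
move=> pa; set z := cauchy_concat pa (fun i => rep (x_ i)).
have cP i : cauchy_agree (a i) (rep (class z)) (rep (x_ i)).
  apply: cauchy_agree_trans (class_rep (a i) z) _.
  exact: (cauchy_concatP pa (fun i => rep (x_ i))).
exists (class z); split=> [//|y yP]; rewrite -[RHS]repK; apply/class_eq.
apply: (cauchy_agree_local pa) => i.
apply: cauchy_agree_trans (cauchy_agree_sym (class_rep (a i) z)) _.
exact: cauchy_agree_trans (cP i) (cauchy_agree_sym (yP i)).
Qed.

End Completion.

Definition completion {d : Order.disp_t} (A : cbaType d) {R : realType}
  (X : normedModType R) : condSet A :=
  agreeCS (inhabits (class (cauchy_cst (step_cst A (0 : X)))))
    (fun a x => cauchy_agree_refl a (rep x))
    (fun a x y => @cauchy_agree_sym _ _ _ X a (rep x) (rep y))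
    (fun a x y z => @cauchy_agree_trans _ _ _ X a (rep x) (rep y) (rep z))
    (fun a b x y => @cauchy_agree_mono _ _ _ X a b (rep x) (rep y))
    (@completion_C3 d A R X).

(* The conditional real numbers: on $\mathbb{R}_s$ the norm is the absolute
   value, so that $\mathbf{R}$ is the conditional completion of $\mathbb{R}$. *)
Definition condReal {d : Order.disp_t} (A : cbaType d) (R : realType) :
  condSet A := completion A R^o.

Section CompletionOperations.
Context {d : Order.disp_t} {A : cbaType d} {R : realType}.
Implicit Types X Y : normedModType R.

Lemma completion_restr X (x y : cauchy_seq A X) a :
  restr (class x : completion A X) a = restr (class y : completion A X) a <->
  cauchy_agree a x y.
Proof.
split=> [|h].
  move=> /(agree_restrE (fun a x => cauchy_agree_refl a (rep x))
    (fun a x y => @cauchy_agree_sym _ _ _ X a (rep x) (rep y))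
    (fun a x y z => @cauchy_agree_trans _ _ _ X a (rep x) (rep y) (rep z))).
  by move/completion_agreeP.
apply/(agree_restrE (fun a x => cauchy_agree_refl a (rep x))
    (fun a x y => @cauchy_agree_sym _ _ _ X a (rep x) (rep y))
    (fun a x y z => @cauchy_agree_trans _ _ _ X a (rep x) (rep y) (rep z))).
exact/completion_agreeP.
Qed.

(* The embeddings $X\subseteq X_s\subseteq X_c$. *)
Definition step_embed X (x : step A X) : completion A X := class (cauchy_cst x).

Definition embed X (x : X) : completion A X := step_embed (step_cst A x).

Definition zeroc X : completion A X := embed 0.

Definition addc X (x y : completion A X) : completion A X :=
  class (cauchy_add (rep x) (rep y)).

Definition scalec X (k : condReal A R) (x : completion A X) : completion A X :=
  class (cauchy_scale (rep k) (rep x)).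

(* $\|[(x_n)]\|_c$, the class of $(\|x_n\|_s)$; for [X := R^o] this is the
   absolute value of $R$. *)
Definition normc X (x : completion A X) : condReal A R :=
  class (cauchy_norm (rep x)).

Definition mulc (k l : condReal A R) : condReal A R := scalec k l.

Definition lec (k l : condReal A R) : Prop := cauchy_le (rep k) (rep l).

Lemma addcE X (x y : cauchy_seq A X) :
  addc (class x) (class y) = class (cauchy_add x y).
Proof. by apply/class_eq/cauchy_add_agree; exact: class_rep. Qed.

Lemma scalecE X (k : cauchy_seq A R^o) (x : cauchy_seq A X) :
  scalec (class k) (class x) = class (cauchy_scale k x).
Proof. by apply/class_eq/cauchy_scale_agree; exact: class_rep. Qed.

Lemma normcE X (x : cauchy_seq A X) : normc (class x) = class (cauchy_norm x).
Proof. by apply/class_eq/cauchy_norm_agree; exact: class_rep. Qed.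

Lemma lecE (k l : cauchy_seq A R^o) : lec (class k) (class l) <-> cauchy_le k l.
Proof.
have hk := class_rep \top%O k; have hl := class_rep \top%O l.
split; first exact: (cauchy_le_agree hk hl).
exact: (cauchy_le_agree (cauchy_agree_sym hk) (cauchy_agree_sym hl)).
Qed.

(** * Dual pairs *)

Section ConditionalForms.
Variables X Y : normedModType R.
Implicit Types B : completion A X -> completion A Y -> condReal A R.

Definition cond_bilinear B : Prop :=
  [/\ forall x x' y, B (addc x x') y = addc (B x y) (B x' y),
      forall x y y', B x (addc y y') = addc (B x y) (B x y'),
      forall k x y, B (scalec k x) y = mulc k (B x y) &
      forall k x y, B x (scalec k y) = mulc k (B x y)].

Definition cond_bilinear_form B : Prop :=
  @stable _ _ (prodCS (completion A X) (completion A Y)) (condReal A R)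
    (fun p => B p.1 p.2) /\ cond_bilinear B.

Definition cond_separating B : Prop :=
  (forall x, (forall y, B x y = zeroc R^o) -> x = zeroc X) /\
  (forall y, (forall x, B x y = zeroc R^o) -> y = zeroc Y).

Definition cond_dual_pair B : Prop :=
  cond_bilinear_form B /\ cond_separating B.

(* Norm continuity of a bilinear form. It does not follow from [cond_dual_pair]:
   already for A = {0,1} and X, Y the finitely supported sequences with the l2
   norm, adding $\varphi(x)\varphi(y)$ to the inner product of l2, with
   $\varphi$ a discontinuous linear functional vanishing on X, gives a second
   separating bilinear extension. *)
Definition cond_bounded B : Prop := exists k : condReal A R,
  forall x y, lec (normc (B x y)) (mulc k (mulc (normc x) (normc y))).

End ConditionalForms.
End CompletionOperations.

Section DualPairs.
Context {R : realType} {X Y : normedModType R}.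
Variable b : X -> Y -> R.

Definition dual_pair : Prop :=
  [/\ forall y, scalar (b^~ y),
      forall x, scalar (b x),
      forall x, (forall y, b x y = 0) -> x = 0 &
      forall y, (forall x, b x y = 0) -> y = 0].

(* $\sigma(X,Y)$ and $\sigma(Y,X)$ *)
Definition sigma_l : Type :=
  sup_topology (fun y => Topological.on (initial_topology (b^~ y))).
Definition sigma_r : Type :=
  sup_topology (fun x => Topological.on (initial_topology (b x))).

HB.instance Definition _ := Topological.on sigma_l.
HB.instance Definition _ := Topological.on sigma_r.

End DualPairs.
Arguments sigma_l {R X Y} b.
Arguments sigma_r {R X Y} b.

Section SigmaConvergence.
Context {R : realType} {X Y : normedModType R} (b : X -> Y -> R).

Lemma sigma_l_cvg (F : set_system X) (x : X) : Filter F ->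
  F `=>` @nbhs (sigma_l b) (sigma_l b) x <-> forall y, (b^~ y) @ F --> b x y.
Proof.
move=> FF; apply: iff_trans (@cvg_sup _ _ _ F x FF) _; split=> h y.
  apply: (@cvg_comp _ _ _ id (b^~ y) F (@nbhs _ (initial_topology (b^~ y)) x)).
    exact: h.
  exact: (@initial_continuous _ _ (b^~ y) x).
move=> U; rewrite (@nbhsE (initial_topology (b^~ y))) => -[V [[W oW <-] xW] sU].
by apply: filterS sU _; apply: (h y); exact: open_nbhs_nbhs.
Qed.

Lemma sigma_r_cvg (F : set_system Y) (y : Y) : Filter F ->
  F `=>` @nbhs (sigma_r b) (sigma_r b) y <-> forall x, (b x) @ F --> b x y.
Proof.
move=> FF; apply: iff_trans (@cvg_sup _ _ _ F y FF) _; split=> h x.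
  apply: (@cvg_comp _ _ _ id (b x) F (@nbhs _ (initial_topology (b x)) y)).
    exact: h.
  exact: (@initial_continuous _ _ (b x) y).
move=> U; rewrite (@nbhsE (initial_topology (b x))) => -[V [[W oW <-] xW] sU].
by apply: filterS sU _; apply: (h x); exact: open_nbhs_nbhs.
Qed.

End SigmaConvergence.

(* Main.v *)
(** The form is $\langle[(x_n)],[(y_n)]\rangle_c=[(\langle x_n,y_n\rangle)]$.

    Separation: let $\langle x,y\rangle_c=0$ for all $y\in Y$, let $n_0$ be a
    Cauchy index of $(x_n)$ for $t$, and suppose $x_{n_0}=u\in X$ on some
    nonzero condition with $\|u\|>t$. The $t$-ball is weakly closed, so
    finitely many functionals $y_1,\dots,y_k$ show $\|u-w\|>t$ for every $w$ with all
    $|\langle w,y_j\rangle|$ small. A late value $w$ of $(x_n)$ has this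
    property on a smaller condition, contradicting $\|u-w\|<t$. Finiteness of
    the family replaces any conditional topology.

    Uniqueness: below any nonzero condition $x$ and $y$ are within any $t>0$ of
    constants $u\in X$ and $v\in Y$, and two bounded forms that agree at every
    $(u,v)$ are then arbitrarily close at $(x,y)$. *)

Require Import Defs.
From mathcomp Require Import all_boot all_order all_algebra.
From mathcomp Require Import all_classical all_reals all_analysis.
From mathcomp Require Import ring lra.

Import Order.Theory GRing.Theory Num.Theory.
Import numFieldNormedType.Exports.
Local Open Scope classical_set_scope.
Local Open Scope ring_scope.

Set Implicit Arguments.
Unset Strict Implicit.

(** * Real bounds for conditional Cauchy sequences on a condition *)

Section NormBounds.
Context {d : Order.disp_t} {A : cbaType d} {R : realType}.
Implicit Types (X : normedModType R) (a c e : A) (s t : R).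

Lemma step_pos_cst t : 0 < t -> step_pos (step_cst A t).
Proof.
by move=> t0; apply: step_pos_intro => e e0; exists e, t; split=> //;
  exact: step_cst_le.
Qed.

Lemma le_step_nat_max4 (n1 n2 n3 n4 : step A nat) : exists n0, forall n,
  le_step_nat n0 n -> [/\ le_step_nat n1 n, le_step_nat n2 n,
    le_step_nat n3 n & le_step_nat n4 n].
Proof.
have [m1 m2] := le_step_nat_max n1 n2; have [m3 m4] := le_step_nat_max n3 n4.
have [p1 p2] := le_step_nat_max (step_map2 maxn n1 n2) (step_map2 maxn n3 n4).
exists (step_map2 maxn (step_map2 maxn n1 n2) (step_map2 maxn n3 n4)) => n nP.
have q1 := le_step_nat_trans p1 nP; have q2 := le_step_nat_trans p2 nP.
by split; [exact: le_step_nat_trans q1|exact: le_step_nat_trans q1|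
  exact: le_step_nat_trans q2|exact: le_step_nat_trans q2].
Qed.

(* $\|x\|_c\le t$ on [a], in terms of representatives. *)
Definition norm_le X a t (x : cauchy_seq A X) : Prop :=
  forall s, t < s -> exists n0, forall n, le_step_nat n0 n ->
    forall c u, c <> \bot%O -> (c <= a)%O -> (c <= x n u)%O -> `|u| < s.

(** The triangle inequality with half of the slack [s - t] for each term. Hence the bound depends
    only on the class in $X_c$. *)
Lemma norm_le_agree X a t (x y : cauchy_seq A X) :
  cauchy_agree a x y -> norm_le a t x -> norm_le a t y.
Proof.
move=> xy xt s ts; have h0 : 0 < (s - t) / 2 by lra.
have [n1 n1P] := xy _ (step_pos_cst h0).
have h1 : t < t + (s - t) / 2 by lra.
have [n2 n2P] := xt _ h1; have [m1 m2] := le_step_nat_max n1 n2.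
exists (step_map2 maxn n1 n2) => n nP c v c0 ca Lv.
have /step_rel_onP h := n1P _ (le_step_nat_trans m1 nP).
step_decide (x n) u.
have uv := h _ _ _ c0 ca (step_norm_sub_le Lu Lv) (step_cst_le _ c).
have ut := n2P _ (le_step_nat_trans m2 nP) _ _ c0 ca Lu.
have := ler_normB u (u - v); rewrite opprB addrC subrK; lra.
Qed.

Lemma norm_le_mono X a c t (x : cauchy_seq A X) :
  norm_le a t x -> (c <= a)%O -> norm_le c t x.
Proof.
move=> xt ca s /xt[n0 h]; exists n0 => n /h{}h e u e0 ec; apply: h => //.
exact: le_trans ec ca.
Qed.

Lemma norm_le_weak X a s t (x : cauchy_seq A X) :
  norm_le a s x -> s <= t -> norm_le a t x.
Proof. by move=> xs st r tr; apply: xs; exact: le_lt_trans tr. Qed.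

Lemma norm_le_add X a s t (x y : cauchy_seq A X) :
  norm_le a s x -> norm_le a t y -> norm_le a (s + t) (cauchy_add x y).
Proof.
move=> xs yt r str; have h1 : s < s + (r - s - t) / 2 by lra.
have h2 : t < t + (r - s - t) / 2 by lra.
have [n1 n1P] := xs _ h1; have [n2 n2P] := yt _ h2.
have [m1 m2] := le_step_nat_max n1 n2.
exists (step_map2 maxn n1 n2) => n nP c w c0 ca Lw.
step_decide (x n) u; step_decide (y n) v.
rewrite (step_inj c0 Lw (step_map2_le (fun u v => u + v) Lu Lv)).
have := n1P _ (le_step_nat_trans m1 nP) _ _ c0 ca Lu.
have := n2P _ (le_step_nat_trans m2 nP) _ _ c0 ca Lv.
have := ler_normD u v; lra.
Qed.

Lemma norm_le_scale X a s t (k : cauchy_seq A R^o) (x : cauchy_seq A X) :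
  0 <= s -> 0 <= t -> norm_le a s k -> norm_le a t x ->
  norm_le a (s * t) (cauchy_scale k x).
Proof.
move=> s0 t0 ks xt r str.
(* Room for an error in both factors: $(s+e)(t+e)=st+e(s+t+e)$, and $e\le1$ bounds this by
   $st+e(s+t+1)\le r$. *)
have [e e0 er] : exists2 e, 0 < e & (s + e) * (t + e) <= r.
  have D0 : 0 < s + t + 1 by lra.
  exists (Num.min 1 ((r - s * t) / (s + t + 1))).
    by rewrite lt_min ltr01 divr_gt0// subr_gt0.
  set e := Num.min _ _; have e1 : e <= 1 by rewrite ge_min lexx.
  have eD : e * (s + t + 1) <= r - s * t.
    by rewrite -ler_pdivlMr// ge_min lexx orbT.
  have e0 : 0 < e by rewrite lt_min ltr01 divr_gt0// subr_gt0.
  nra.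
have h1 : s < s + e by lra.
have h2 : t < t + e by lra.
have [n1 n1P] := ks _ h1; have [n2 n2P] := xt _ h2.
have [m1 m2] := le_step_nat_max n1 n2.
exists (step_map2 maxn n1 n2) => n nP c w c0 ca Lw.
step_decide (k n) u; step_decide (x n) v.
rewrite (step_inj c0 Lw (step_map2_le (fun (s : R) (u : X) => s *: u) Lu Lv)).
rewrite normrZ (lt_le_trans _ er)// ltr_pM//.
  exact: n1P (le_step_nat_trans m1 nP) _ _ c0 ca Lu.
exact: n2P (le_step_nat_trans m2 nP) _ _ c0 ca Lv.
Qed.

Lemma norm_le_norm X a t (x : cauchy_seq A X) :
  norm_le a t x -> norm_le a t (cauchy_norm x).
Proof.
move=> xt s /xt[n0 h]; exists n0 => n /h{}h c w c0 ca Lw; step_decide (x n) u.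
rewrite (step_inj c0 Lw (step_map_le (fun u : X => `|u|) Lu)) normr_id.
exact: h c0 ca Lu.
Qed.

(** Late values satisfy $\|u\|<v+(s-t)/2$ with $v$ the value of [k]. This turns an inequality in $R$
    into a real bound on a condition. *)
Lemma norm_le_normE X a t (x : cauchy_seq A X) (k : cauchy_seq A R^o) :
  cauchy_le (cauchy_norm x) k -> norm_le a t k -> norm_le a t x.
Proof.
move=> xk kt s ts; have h1 : t < t + (s - t) / 2 by lra.
have h2 : 0 < (s - t) / 2 by lra.
have [n1 n1P] := kt _ h1; have [n2 n2P] := xk _ (step_pos_cst h2).
have [m1 m2] := le_step_nat_max n1 n2.
exists (step_map2 maxn n1 n2) => n nP c u c0 ca Lu; step_decide (k n) v.
have := n1P _ (le_step_nat_trans m1 nP) _ _ c0 ca Lv.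
have := step_relE (n2P _ (le_step_nat_trans m2 nP)) c0
  (step_map_le (fun t => - t) (step_cst_le _ c))
  (step_map2_le (fun u v : R => u - v) Lv
     (step_map_le (fun u : X => `|u|) Lu)).
have := ler_norm (v : R); rewrite -[X in `|X|]/(v : R^o); lra.
Qed.

(** The eventual bound of a Cauchy sequence is a step function, hence constant on some smaller
    nonzero condition. *)
Lemma norm_le_locally X (x : cauchy_seq A X) e : e <> \bot%O ->
  exists c t, [/\ c <> \bot%O, (c <= e)%O, 0 <= t & norm_le c t x].
Proof.
move=> e0; have [M [n0 n0P]] := cauchy_bounded x; have ee := lexx e.
step_decide M t; exists c, `|t|; split=> // s ts.
exists n0 => n /n0P h f u f0 fc Lu.
apply: le_lt_trans ts; apply: le_trans (ler_norm t); apply: ltW.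
by apply: (step_relE h f0 _ (le_trans fc Lt));
  exact: (step_map_le (fun u : X => `|u|)).
Qed.

(** [u] is the value of [x] at a Cauchy index, on a condition where that value is constant. *)
Lemma cauchy_seq_near_cst X (x : cauchy_seq A X) e t : e <> \bot%O -> 0 < t ->
  exists c u, [/\ c <> \bot%O, (c <= e)%O &
    exists n0, forall n, le_step_nat n0 n -> forall f v, f <> \bot%O ->
      (f <= c)%O -> (f <= x n v)%O -> `|v - u| < t].
Proof.
move=> e0 t0; have ee := lexx e.
have [n0 n0P] := Defs.cauchyP x (step_pos_cst t0).
have nn := @le_step_nat_refl _ _ n0.
step_decide (x n0) u; exists c, u; split=> //.
exists n0 => n nP f v f0 fc Lv.
apply: (step_relE (n0P _ _ nP nn) f0 _ (step_cst_le _ f)).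
by apply: step_norm_sub_le => //; exact: le_trans Lu.
Qed.

(* A Cauchy sequence which is locally arbitrarily small at late indices is
   small at all indices from a Cauchy modulus on: no choice of a common
   conditional index is needed. *)
Lemma class_eq0 X (x : cauchy_seq A X) :
  (forall e t, e <> \bot%O -> 0 < t -> exists c,
    [/\ c <> \bot%O, (c <= e)%O & norm_le c t x]) ->
  class x = zeroc X.
Proof.
move=> h; apply/class_eq => r /step_halfP r0.
have [n0 n0P] := Defs.cauchyP x r0.
exists n0 => n nP; apply: step_rel_on_intro => e e0 _; have ee := lexx e.
step_decide (x n) u; step_decide r t.
have Lt2 := step_map_le (fun t => t / 2) Lt.
have t2 := step_posE r0 c0 Lt2.
have t4 : 0 < t / 2 / 2 by lra.
have [f [f0 fc ft]] := h _ _ c0 t4.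
have t42 : t / 2 / 2 < t / 2 by lra.
have [n1 n1P] := ft _ t42.
(* The index [n1] depends on the condition [f]; the Cauchy property carries the bound from the
   maximum back to the given [n]. *)
have [m1 m2] := le_step_nat_max n n1.
have := n1P _ m2; have := n0P _ _ nP (le_step_nat_trans nP m1).
set m := step_map2 maxn n n1 => h1 h2.
have [g [v [g0 gf gv]]] := step_pick (x m) f0.
have gc := le_trans gf fc; exists g, `|u - 0|, t; split.
- exact: g0.
- exact: le_trans gc ee.
- by apply: step_norm_sub_le (step_cst_le _ _); exact: le_trans Lu.
- exact: le_trans gc Lt.
have uv := step_relE h1 g0 
  (step_norm_sub_le (le_trans gc Lu) gv) (le_trans gc Lt2).
have v2 := h2 _ _ g0 gf gv.
rewrite subr0; have := ler_normD (u - v) v; rewrite subrK; lra.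
Qed.

End NormBounds.

(** * Local norm bounds and differences in the completion *)

Section CompletionDistance.
Context {d : Order.disp_t} {A : cbaType d} {R : realType}.
Implicit Types (X : normedModType R) (a c e : A) (s t : R).

Lemma completion_ind X (P : completion A X -> Prop) :
  (forall x : cauchy_seq A X, P (class x)) -> forall x, P x.
Proof. by move=> h x; rewrite -[x]repK; exact: h. Qed.

(** Such sequences have zero difference at every index. Algebraic identities in $X_c$ thereby reduce
    to identities between values on small conditions. *)
Lemma class_ext X (x y : cauchy_seq A X) :
  (forall n, step_agree \top%O (x n) (y n)) -> class x = class y.
Proof.
move=> h; apply/class_eq => r r0; exists (step_cst A 0%N) => n _.
have /step_agreeP xy := h n; apply: step_rel_on_intro => e e0 _.
have ee := lexx e; step_decide (x n) u; step_decide (y n) v; step_decide r t.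
exists c, `|u - v|, t; split=> //; first exact: step_norm_sub_le.
by rewrite (xy _ _ _ c0 (lex1 _) Lu Lv) subrr normr0; exact: step_posE Lt.
Qed.

(** A real bound on a condition rather than one in $R_+$: every element has such a bound below any
    nonzero condition, and estimates become inequalities between real numbers. *)
Definition normc_le X a t (x : completion A X) : Prop := norm_le a t (rep x).

Lemma normc_leE X a t (x : cauchy_seq A X) :
  normc_le a t (class x) <-> norm_le a t x.
Proof.
split; apply: norm_le_agree; first exact: class_rep.
exact: cauchy_agree_sym (class_rep _ _).
Qed.

Lemma normc_le_add X a s t (x y : completion A X) :
  normc_le a s x -> normc_le a t y -> normc_le a (s + t) (addc x y).
Proof. by move=> xs yt; apply/normc_leE/norm_le_add. Qed.

Lemma normc_le_scale X a s t (k : condReal A R) (x : completion A X) :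
  0 <= s -> 0 <= t -> normc_le a s k -> normc_le a t x ->
  normc_le a (s * t) (scalec k x).
Proof. by move=> s0 t0 ks xt; apply/normc_leE/norm_le_scale. Qed.

Lemma normc_le_norm X a t (x : completion A X) :
  normc_le a t x -> normc_le a t (normc x).
Proof. by move=> xt; apply/normc_leE/norm_le_norm. Qed.

Lemma normc_le_lec X a t (x : completion A X) (k : condReal A R) :
  lec (normc x) k -> normc_le a t k -> normc_le a t x.
Proof.
elim/completion_ind: x => x; elim/completion_ind: k => k.
by rewrite normcE => /lecE xk /normc_leE kt; apply/normc_leE/norm_le_normE/kt.
Qed.

Lemma normc_le_embed X a (u : X) : normc_le a `|u| (embed u : completion A X).
Proof.
apply/normc_leE => s us; exists (step_cst A 0%N) => n _ c v c0 _ Lv.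
by rewrite (step_inj c0 Lv (step_cst_le _ c)).
Qed.

Lemma normc_eq0 X (x : completion A X) :
  (forall e t, e <> \bot%O -> 0 < t -> exists c,
    [/\ c <> \bot%O, (c <= e)%O & normc_le c t x]) -> x = zeroc X.
Proof. by move=> h; rewrite -[x]repK; exact: class_eq0. Qed.

(** Built from [addc] and [scalec], so that additivity and homogeneity of a form rewrite its
    differences directly. *)
Definition subc X (x y : completion A X) : completion A X :=
  addc x (scalec (embed (-1 : R^o)) y).

Definition cauchy_sub X (x y : cauchy_seq A X) : cauchy_seq A X :=
  cauchy_add x (cauchy_scale (cauchy_cst (step_cst A (-1 : R^o))) y).

Lemma subcE X (x y : cauchy_seq A X) :
  subc (class x) (class y) = class (cauchy_sub x y).
Proof. by rewrite /subc scalecE addcE. Qed.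

Lemma cauchy_add_le X (x y : cauchy_seq A X) n c u v :
  (c <= x n u)%O -> (c <= y n v)%O -> (c <= cauchy_add x y n (u + v)%R)%O.
Proof. exact: (step_map2_le (fun u v => u + v)). Qed.

Lemma cauchy_scale_le X (k : cauchy_seq A R^o) (x : cauchy_seq A X) n c s u :
  (c <= k n s)%O -> (c <= x n u)%O -> (c <= cauchy_scale k x n (s *: u)%R)%O.
Proof. exact: (step_map2_le (fun (s : R) (u : X) => s *: u)). Qed.

Lemma cauchy_sub_le X (x y : cauchy_seq A X) n c u v :
  (c <= x n u)%O -> (c <= y n v)%O -> (c <= cauchy_sub x y n (u - v)%R)%O.
Proof.
move=> Lu Lv; rewrite -scaleN1r; apply: cauchy_add_le => //.
by apply: cauchy_scale_le => //; exact: step_cst_le.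
Qed.

Lemma subc_trans X (y x z : completion A X) :
  subc x z = addc (subc x y) (subc y z).
Proof.
elim/completion_ind: x => x; elim/completion_ind: y => y.
elim/completion_ind: z => z; rewrite !subcE addcE; apply: class_ext => n.
apply: step_agree_intro => e e0 _; have ee := lexx e.
step_decide (x n) u; step_decide (y n) v; step_decide (z n) w.
exists c, (u - w); split=> //; first exact: cauchy_sub_le.
have -> : u - w = (u - v) + (v - w) by rewrite addrA subrK.
by apply: cauchy_add_le; exact: cauchy_sub_le.
Qed.

Lemma subc_sym X (x y : completion A X) :
  subc y x = scalec (embed (-1 : R^o)) (subc x y).
Proof.
elim/completion_ind: x => x; elim/completion_ind: y => y.
rewrite !subcE scalecE; apply: class_ext => n.
apply: step_agree_intro => e e0 _; have ee := lexx e.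
step_decide (x n) u; step_decide (y n) v.
exists c, (v - u); split=> //; first exact: cauchy_sub_le.
have -> : v - u = -1 *: (u - v) by rewrite scaleN1r opprB.
by apply: cauchy_scale_le; [exact: step_cst_le|exact: cauchy_sub_le].
Qed.

Lemma subc_eq0 X (x y : completion A X) : subc x y = zeroc X -> x = y.
Proof.
elim/completion_ind: x => x; elim/completion_ind: y => y xy.
transitivity (addc (subc (class x) (class y)) (class y)).
  rewrite subcE addcE; apply: class_ext => n.
  apply: step_agree_intro => e e0 _; have ee := lexx e.
  step_decide (x n) u; step_decide (y n) v; exists c, u; split=> //.
  by rewrite -[u in X in (_ <= X)%O](subrK v); apply: cauchy_add_le => //;
    exact: cauchy_sub_le.
rewrite xy addcE; apply: class_ext => n.
apply: step_agree_intro => e e0 _; have ee := lexx e.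
step_decide (y n) v; exists c, v; split=> //.
by rewrite -[v in X in (_ <= X)%O]add0r; apply: cauchy_add_le => //;
  exact: step_cst_le.
Qed.

Lemma normc_le_subC X a t (x y : completion A X) : 0 <= t ->
  normc_le a t (subc x y) -> normc_le a t (subc y x).
Proof.
move=> t0 xy; rewrite subc_sym -[t]mul1r; apply: normc_le_scale => //.
by have := @normc_le_embed R^o a (-1); rewrite normrN1.
Qed.

Lemma normc_le_locally X (x : completion A X) e : e <> \bot%O ->
  exists c t, [/\ c <> \bot%O, (c <= e)%O, 0 <= t & normc_le c t x].
Proof. exact: norm_le_locally. Qed.

(** Shrinking the condition allows approximation by elements of $X$ instead of step functions: the
    value at a Cauchy index is constant there. *)
Lemma embed_dense_locally X (x : completion A X) e t : e <> \bot%O -> 0 < t ->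
  exists c u, [/\ c <> \bot%O, (c <= e)%O & normc_le c t (subc x (embed u))].
Proof.
elim/completion_ind: x => x e0 t0.
have [c [u [c0 ce [n0 n0P]]]] := cauchy_seq_near_cst x e0 t0.
exists c, u; split=> //; rewrite subcE; apply/normc_leE => s ts.
exists n0 => n nP f w f0 fc Lw.
have [g [v [g0 gf Lv]]] := step_pick (x n) f0.
have L := cauchy_sub_le (y := cauchy_cst (step_cst A u)) Lv (step_cst_le _ _).
rewrite (step_inj g0 (le_trans gf Lw) L); apply: lt_trans ts.
exact: n0P nP _ _ g0 (le_trans gf fc) Lv.
Qed.

End CompletionDistance.

(** * Uniqueness: bounded forms are determined by their values on constants *)

Section BilinearForms.
Context {d : Order.disp_t} {A : cbaType d} {R : realType}.
Variables X Y : normedModType R.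
Implicit Types B : completion A X -> completion A Y -> condReal A R.

(** Since $z/(z+1)\le1$; the added $1$ keeps the denominator positive at $z=0$. *)
Lemma quarter_bound (r z : R) : 0 < r -> 0 <= z ->
  z * (r / (4 * (z + 1))) <= r / 4.
Proof.
move=> r0 z0; have z1 : 0 < z + 1 by lra.
have -> : z * (r / (4 * (z + 1))) = (z / (z + 1)) * (r / 4) by field; lra.
by rewrite ler_piMl//; [lra|rewrite ler_pdivrMr// mul1r; lra].
Qed.

(** Split $B(x,y)-B(u,v)=B(x-u,y)+B(u,y-v)$ and bound each term by [Bk]. *)
Lemma cond_bilinear_bound_dist B (k : condReal A R) x y u v c (K t p q : R) :
  cond_bilinear B ->
  (forall x y, lec (normc (B x y)) (mulc k (mulc (normc x) (normc y)))) ->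
  0 <= K -> 0 <= t -> 0 <= p -> 0 <= q ->
  normc_le c K k -> normc_le c t y ->
  normc_le c p (subc x (embed u)) -> normc_le c q (subc y (embed v)) ->
  normc_le c (K * (p * t) + K * (`|u| * q))
    (subc (B x y) (B (embed u) (embed v))).
Proof.
move=> [Dl Dr Zl Zr] Bk K0 t0 p0 q0 kK yt xu yv.
rewrite (subc_trans (B (embed u) y)); apply: normc_le_add.
  have -> : subc (B x y) (B (embed u) y) = B (subc x (embed u)) y.
    by rewrite /subc Dl Zl.
  apply: (normc_le_lec (Bk _ _)); apply: normc_le_scale => //.
    exact: mulr_ge0.
  by apply: normc_le_scale => //; exact: normc_le_norm.
have -> : subc (B (embed u) y) (B (embed u) (embed v)) =
    B (embed u) (subc y (embed v)) by rewrite /subc Dr Zr.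
apply: (normc_le_lec (Bk _ _)); apply: normc_le_scale => //.
  exact: mulr_ge0.
by apply: normc_le_scale => //; apply: normc_le_norm => //;
  exact: normc_le_embed.
Qed.

Lemma cond_bounded_eq B B' :
  cond_bilinear B -> cond_bounded B -> cond_bilinear B' -> cond_bounded B' ->
  (forall u v, B (embed u) (embed v) = B' (embed u) (embed v)) ->
  forall x y, B x y = B' x y.
Proof.
move=> Blin [k Bk] Blin' [k' Bk'] BB' x y.
apply/subc_eq0/normc_eq0 => e r e0 r0.
have [c1 [K [c10 c1e K0 kK]]] := normc_le_locally k e0.
have [c2 [K' [c20 c21 K'0 kK']]] := normc_le_locally k' c10.
have [c3 [t [c30 c32 t0 yt]]] := normc_le_locally y c20.
pose M := K + K'; have M0 : 0 <= M by rewrite addr_ge0.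
(* The order of choices matters: the tolerance for [u] uses the bound [t] of [y], and the one for
   [v] uses $\|u\|$. Each of the two error terms is then at most $r/4$, for both forms since [M]
   dominates [K] and [K']. *)
have D1 : 0 < 4 * (M * t + 1) by rewrite mulr_gt0// ltr_wpDl// mulr_ge0.
have [c4 [u [c40 c43 xu]]] := embed_dense_locally x c30 (divr_gt0 r0 D1).
have D2 : 0 < 4 * (M * `|u| + 1) by rewrite mulr_gt0// ltr_wpDl// mulr_ge0.
have [c5 [v [c50 c54 yv]]] := embed_dense_locally y c40 (divr_gt0 r0 D2).
have c53 := le_trans c54 c43; have c52 := le_trans c53 c32.
have c51 := le_trans c52 c21.
have bound K1 B1 k1 : cond_bilinear B1 ->
    (forall x y, lec (normc (B1 x y)) (mulc k1 (mulc (normc x) (normc y)))) ->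
    K1 <= M -> normc_le c5 K1 k1 ->
    normc_le c5 (r / 2) (subc (B1 x y) (B1 (embed u) (embed v))).
  move=> lin1 h1 K1M kK1; have {}kK1 := norm_le_weak kK1 K1M.
  apply: norm_le_weak (cond_bilinear_bound_dist lin1 h1 M0 t0 _ _ kK1 _ _ _) _.
  - exact: ltW (divr_gt0 r0 D1).
  - exact: ltW (divr_gt0 r0 D2).
  - exact: norm_le_mono yt c53.
  - exact: norm_le_mono xu c54.
  - exact: yv.
  have Mt : 0 <= M * t by rewrite mulr_ge0.
  have Mu : 0 <= M * `|u| by rewrite mulr_ge0.
  have := quarter_bound r0 Mt; have := quarter_bound r0 Mu.
  rewrite [r / _ * t]mulrC !mulrA; lra.
exists c5; split=> //; first exact: le_trans c51 c1e.
have -> : r = r / 2 + r / 2 by lra.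
(* The common value of both forms at the constants is the intermediate point. *)
rewrite (subc_trans (B (embed u) (embed v))); apply: normc_le_add.
  by apply: (bound K _ k) => //; [rewrite lerDl|exact: norm_le_mono kK c51].
rewrite BB'; apply: normc_le_subC; first lra.
by apply: (bound K' _ k') => //; [rewrite lerDr|exact: norm_le_mono kK' c52].
Qed.

End BilinearForms.

(** * Existence: the form on representatives *)

Section Extension.
Context {d : Order.disp_t} {A : cbaType d} {R : realType}.
Context {X Y : normedModType R} {b : X -> Y -> R}.
Hypotheses (b_linl : forall y, scalar (b^~ y)) (b_linr : forall x, scalar (b x))
  (b_le : forall x y, `|b x y| <= `|x| * `|y|).

Lemma form_Dl x x' y : b (x + x') y = b x y + b x' y.
Proof. by have := b_linl y 1 x x'; rewrite /= scale1r mul1r. Qed.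

Lemma form_Dr x y y' : b x (y + y') = b x y + b x y'.
Proof. by have := b_linr x 1 y y'; rewrite /= scale1r mul1r. Qed.

Lemma form_0l y : b 0 y = 0.
Proof. by have := form_Dl 0 0 y; rewrite addr0; lra. Qed.

Lemma form_0r x : b x 0 = 0.
Proof. by have := form_Dr x 0 0; rewrite addr0; lra. Qed.

Lemma form_Zl k x y : b (k *: x) y = k * b x y.
Proof. by have := b_linl y k x 0; rewrite /= !addr0 form_0l addr0. Qed.

Lemma form_Zr k x y : b x (k *: y) = k * b x y.
Proof. by have := b_linr x k y 0; rewrite /= !addr0 form_0r addr0. Qed.

(** The splitting $b(u,v)-b(u',v')=b(u,v-v')+b(u-u',v')$ leaves two terms below $t/2$: each
    tolerance carries the bound of the opposite factor. *)
Lemma form_dist (u u' : X) (v v' : Y) (s1 s2 t : R) :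
  `|u| < s1 -> `|v'| < s2 -> 0 < t ->
  `|u - u'| < t / (2 * (`|s2| + 1)) -> `|v - v'| < t / (2 * (`|s1| + 1)) ->
  `|b u v - b u' v'| < t.
Proof.
move=> us vs t0 uu vv.
have -> : b u v - b u' v' = b u (v - v') + b (u - u') v'.
  have := form_Dr u v' (v - v'); rewrite addrC subrK => ->.
  have := form_Dl (u - u') u' v'; rewrite subrK => ->; ring.
rewrite (le_lt_trans (ler_normD _ _))//.
have h (p q s : R) : 0 <= p -> p < s -> 0 <= q -> q < t / (2 * (`|s| + 1)) ->
    p * q < t / 2.
  move=> p0 ps q0; have sp : 0 < `|s| + 1 by rewrite ltr_pwDr.
  rewrite ltr_pdivlMr; last lra.
  have := ler_norm s; nra.
have := h _ _ _ (normr_ge0 _) us (normr_ge0 _) vv.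
have := h _ _ _ (normr_ge0 _) vs (normr_ge0 _) uu.
have := b_le u (v - v'); have := b_le (u - u') v'; lra.
Qed.

(** One estimate serves twice: with two indices of the same sequences it gives the Cauchy property,
    with one index of agreeing sequences the independence of representatives. *)
Lemma step_form_dist a (M1 M2 r : step A R) (x x' : step A X)
  (y y' : step A Y) :
  step_pos r -> lt_step (step_norm x) M1 -> lt_step (step_norm y') M2 ->
  lt_step_on a (step_norm (step_sub x x')) (step_ratio r M2) ->
  lt_step_on a (step_norm (step_sub y y')) (step_ratio r M1) ->
  lt_step_on a (@step_norm _ _ _ R^o
    (@step_sub _ _ _ R^o (step_map2 b x y) (step_map2 b x' y'))) r.
Proof.
move=> r0 xM yM /step_rel_onP xx /step_rel_onP yy.
apply: step_rel_on_intro => e e0 ea; have ee := lexx e.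
step_decide x u; step_decide x' u'; step_decide y v; step_decide y' v'.
step_decide r t; step_decide M1 s1; step_decide M2 s2.
exists c, `|b u v - b u' v'|, t; split=> //.
  by apply: (@step_norm_sub_le _ _ _ R^o); exact: step_map2_le.
have ratio (M : step A R) s : (c <= M s)%O ->
    (c <= step_ratio r M (t / (2 * (`|s| + 1))))%O.
  exact: (step_map2_le (fun t s => t / (2 * (`|s| + 1))) Lt).
apply: (@form_dist _ _ _ _ s1 s2).
- exact: (step_relE xM c0 (step_map_le (fun u : X => `|u|) Lu) Ls1).
- exact: (step_relE yM c0 (step_map_le (fun u : Y => `|u|) Lv') Ls2).
- exact: step_posE r0 c0 Lt.
- exact: (xx _ _ _ c0 ea (step_norm_sub_le Lu Lu') (ratio _ _ Ls2)).
- exact: (yy _ _ _ c0 ea (step_norm_sub_le Lv Lv') (ratio _ _ Ls1)).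
Qed.

Lemma form_seq_stable (x : cauchy_seq A X) (y : cauchy_seq A Y) :
  @stable _ _ (stepCS A nat) (stepCS A R^o) (fun n => step_map2 b (x n) (y n)).
Proof.
by apply: agree_cond_seq => a m n mn; apply: step_map2_agree;
  exact: cond_seq_agree.
Qed.

Lemma form_seq_cauchy (x : cauchy_seq A X) (y : cauchy_seq A Y) :
  is_cauchy (CondSeq (form_seq_stable x y)).
Proof.
move=> r r0.
have [M1 [p1 p1P]] := cauchy_bounded x; have [M2 [p2 p2P]] := cauchy_bounded y.
have [n1 n1P] := Defs.cauchyP x (@step_ratio_pos _ _ _ _ M2 r0).
have [n2 n2P] := Defs.cauchyP y (@step_ratio_pos _ _ _ _ M1 r0).
have [n0 n0P] := le_step_nat_max4 p1 p2 n1 n2.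
exists n0 => m n /n0P[mp1 mp2 mn1 mn2] /n0P[np1 np2 nn1 nn2].
apply: (step_rel_on1 _ _ _).1.
apply: (step_form_dist r0 (p1P _ mp1) (p2P _ np2)); apply: step_rel_sub.
  exact: n1P.
exact: n2P.
Qed.

Definition cauchy_form (x : cauchy_seq A X) (y : cauchy_seq A Y) :
  cauchy_seq A R^o := CauchySeq (form_seq_cauchy x y).

Lemma cauchy_form_le (x : cauchy_seq A X) (y : cauchy_seq A Y) n c u v :
  (c <= x n u)%O -> (c <= y n v)%O -> (c <= cauchy_form x y n (b u v))%O.
Proof. exact: step_map2_le. Qed.

Lemma cauchy_form_agree a (x x' : cauchy_seq A X) (y y' : cauchy_seq A Y) :
  cauchy_agree a x x' -> cauchy_agree a y y' ->
  cauchy_agree a (cauchy_form x y) (cauchy_form x' y').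
Proof.
move=> xx yy r r0.
have [M1 [p1 p1P]] := cauchy_bounded x; have [M2 [p2 p2P]] := cauchy_bounded y'.
have [n1 n1P] := xx _ (@step_ratio_pos _ _ _ _ M2 r0).
have [n2 n2P] := yy _ (@step_ratio_pos _ _ _ _ M1 r0).
have [n0 n0P] := le_step_nat_max4 p1 p2 n1 n2.
exists n0 => n /n0P[np1 np2 nn1 nn2].
by apply: (step_form_dist r0 (p1P _ np1) (p2P _ np2)); [exact: n1P|exact: n2P].
Qed.

Definition formc (x : completion A X) (y : completion A Y) : condReal A R :=
  class (cauchy_form (rep x) (rep y)).

Lemma formcE (x : cauchy_seq A X) (y : cauchy_seq A Y) :
  formc (class x) (class y) = class (cauchy_form x y).
Proof. by apply/class_eq/cauchy_form_agree; exact: class_rep. Qed.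

Lemma formc_embed u v : formc (embed u) (embed v) = embed (b u v : R^o).
Proof.
rewrite formcE; apply: class_ext => n; apply: step_agree_intro => e e0 _.
exists e, (b u v); split=> //; last exact: step_cst_le.
by apply: cauchy_form_le; exact: step_cst_le.
Qed.

(** By [stable_restr], stability means respecting agreement on each condition, which is
    [cauchy_form_agree]. *)
Lemma formc_stable : @stable _ _ (prodCS (completion A X) (completion A Y))
  (condReal A R) (fun p => formc p.1 p.2).
Proof.
apply/stable_restr => -[x y] [x' y'] a /= h.
have := congr1 fst h; have := congr1 snd h.
rewrite /= -[x]repK -[x']repK -[y]repK -[y']repK.
move=> /completion_restr yy /completion_restr xx; rewrite !formcE.
by apply/completion_restr/cauchy_form_agree.
Qed.

Lemma formc_bilinear : cond_bilinear formc.
Proof.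
split.
- move=> x x' y; rewrite -[x]repK -[x']repK -[y]repK.
  rewrite addcE !formcE addcE; apply: class_ext => n.
  apply: step_agree_intro => e e0 _; have ee := lexx e.
  step_decide (rep x n) u; step_decide (rep x' n) u'; step_decide (rep y n) v.
  exists c, (b (u + u') v); split=> //.
    by apply: cauchy_form_le => //; exact: cauchy_add_le.
  by rewrite form_Dl; apply: cauchy_add_le; exact: cauchy_form_le.
- move=> x y y'; rewrite -[x]repK -[y]repK -[y']repK.
  rewrite addcE !formcE addcE; apply: class_ext => n.
  apply: step_agree_intro => e e0 _; have ee := lexx e.
  step_decide (rep x n) u; step_decide (rep y n) v; step_decide (rep y' n) v'.
  exists c, (b u (v + v')); split=> //.
    by apply: cauchy_form_le => //; exact: cauchy_add_le.
  by rewrite form_Dr; apply: cauchy_add_le; exact: cauchy_form_le.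
- move=> k x y; rewrite -[k]repK -[x]repK -[y]repK.
  rewrite /mulc scalecE !formcE scalecE; apply: class_ext => n.
  apply: step_agree_intro => e e0 _; have ee := lexx e.
  step_decide (rep k n) s; step_decide (rep x n) u; step_decide (rep y n) v.
  exists c, (b (s *: u) v); split=> //.
    by apply: cauchy_form_le => //; exact: cauchy_scale_le.
  by rewrite form_Zl; apply: cauchy_scale_le => //; exact: cauchy_form_le.
- move=> k x y; rewrite -[k]repK -[x]repK -[y]repK.
  rewrite /mulc scalecE !formcE scalecE; apply: class_ext => n.
  apply: step_agree_intro => e e0 _; have ee := lexx e.
  step_decide (rep k n) s; step_decide (rep x n) u; step_decide (rep y n) v.
  exists c, (b u (s *: v)); split=> //.
    by apply: cauchy_form_le => //; exact: cauchy_scale_le.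
  by rewrite form_Zr; apply: cauchy_scale_le => //; exact: cauchy_form_le.
Qed.

(** The constant $1$ works: [b_le] compares the values at every index. *)
Lemma formc_bounded : cond_bounded formc.
Proof.
exists (embed (1 : R^o)) => x y; rewrite -[x]repK -[y]repK.
rewrite formcE !normcE /mulc !scalecE; apply/lecE => r r0.
exists (step_cst A 0%N) => m _; apply: step_rel_intro => e e0.
have ee := lexx e; step_decide (rep x m) u; step_decide (rep y m) v.
step_decide r t; exists c, (- t), (1 *: (`|u| *: (`|v| : R^o)) - `|b u v|).
split=> //.
- exact: (step_map_le (fun t => - t)).
- apply: (step_map2_le (fun u v : R => u - v)); last first.
    exact: (step_map_le (fun u : R => `|u|) (cauchy_form_le Lu Lv)).
  apply: cauchy_scale_le; first exact: step_cst_le.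
  apply: cauchy_scale_le; first exact: (step_map_le (fun u : X => `|u|)).
  exact: (step_map_le (fun u : Y => `|u|)).
have t0 := step_posE r0 c0 Lt; have := b_le u v.
by rewrite scale1r /GRing.scale/=; lra.
Qed.

End Extension.

(** * Weak neighbourhoods and separation by finitely many functionals *)

Section Separation.
Context {d : Order.disp_t} {A : cbaType d} {R : realType}.

(** The sets satisfying the conclusion form a filter that converges along every functional, so by
    [sigma_l_cvg] it converges weakly to [u] and contains [U]. *)
Lemma sigma_nbhs (X Y : normedModType R) (f : X -> Y -> R) (u : X) (U : set X) :
  @nbhs (sigma_l f) (sigma_l f) u U ->
  exists (ys : seq Y) (t : R), 0 < t /\
    forall v, (forall y, y \in ys -> `|f u y - f v y| < t) -> U v.
Proof.
pose F : set_system X := [set V | exists (ys : seq Y) (t : R), 0 < t /\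
  forall v, (forall y, y \in ys -> `|f u y - f v y| < t) -> V v].
suff FF : Filter F.
  have : F `=>` @nbhs (sigma_l f) (sigma_l f) u.
    apply/sigma_l_cvg => y; apply/cvgrPdist_lt => t t0.
    by exists [:: y], t; split=> // v /(_ y); apply; exact: mem_head.
  by move=> /[apply].
split; first by exists [::], 1; split.
- move=> P Q [ys [s [s0 Pv]]] [zs [t [t0 Qv]]].
  exists (ys ++ zs), (Num.min s t); split; first by rewrite lt_min s0.
  move=> v h; split; [apply: Pv|apply: Qv] => y yl.
    by have := h y; rewrite mem_cat yl lt_min => /(_ isT)/andP[].
  by have := h y; rewrite mem_cat yl orbT lt_min => /(_ isT)/andP[].
- by move=> P Q PQ [ys [s [s0 Pv]]]; exists ys, s; split=> // v /Pv/PQ.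
Qed.

(** The point $u/t$ lies in the weakly open complement of the unit ball. A basic neighbourhood of it
    inside that complement contains $(u-w)/t$ once its functionals are small at $w$. *)
Lemma ball_separation (X Y : normedModType R) (f : X -> Y -> R)
    (f_lin : forall y, scalar (f^~ y))
    (ball_closed : closed ([set x : X | `|x| <= 1] : set (sigma_l f)))
    (u : X) (t : R) : 0 < t -> t < `|u| ->
  exists (ys : seq Y) (s : R), 0 < s /\
    forall w, (forall y, y \in ys -> `|f w y| < s) -> t < `|u - w|.
Proof.
move=> t0 tu.
have fZ := form_Zl f_lin.
have fB x x' y : f (x - x') y = f x y - f x' y.
  by rewrite form_Dl// -scaleN1r fZ mulN1r.
have oB : open (~` [set x : X | `|x| <= 1] : set (sigma_l f)).
  exact: closed_openC.
have uB : (~` [set x : X | `|x| <= 1]) (t^-1 *: u).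
  rewrite /= normrZ gtr0_norm ?invr_gt0// mulrC; apply/negP.
  by rewrite -ltNge ltr_pdivlMr// mul1r.
have [ys [s [s0 h]]] := sigma_nbhs (open_nbhs_nbhs (conj oB uB)).
exists ys, (s * t); split=> [|w ws]; first exact: mulr_gt0.
have /= : (~` [set x : X | `|x| <= 1]) (t^-1 *: (u - w)).
  apply: h => y /ws wy; rewrite -fB scalerBr subKr fZ normrM.
  by rewrite gtr0_norm ?invr_gt0// mulrC ltr_pdivrMr.
move/negP; rewrite -ltNge normrZ gtr0_norm ?invr_gt0// mulrC.
by rewrite ltr_pdivlMr// mul1r.
Qed.

(** Separation is a hypothesis on [f] here, so that one argument covers both sides of the pair. *)
Lemma separated_eq0 (X Y : normedModType R) (f : X -> Y -> R)
    (x : cauchy_seq A X) :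
  (forall (u : X) (t : R), 0 < t -> t < `|u| ->
    exists (ys : seq Y) (s : R), 0 < s /\
      forall w, (forall y, y \in ys -> `|f w y| < s) -> t < `|u - w|) ->
  (forall (y : Y) (t : R), 0 < t -> exists n0, forall n, le_step_nat n0 n ->
    forall c u, c <> \bot%O -> (c <= x n u)%O -> `|f u y| < t) ->
  class x = zeroc X.
Proof.
move=> sep weak; apply: class_eq0 => e t e0 t0.
have t2 : 0 < t / 2 by lra.
have [c [u [c0 ce [n0 n0P]]]] := cauchy_seq_near_cst x e0 t2.
exists c; split=> // s ts; exists n0 => n nP f' w f0 fc Lw.
have wu := n0P _ nP _ _ f0 fc Lw.
suff ut : `|u| <= t / 2 by have := ler_normD (w - u) u; rewrite subrK; lra.
rewrite leNgt; apply/negP => /(sep _ _ t2)[ys [r [r0 sepw]]].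
(* Since [ys] is finite, a maximum of indices serves all its functionals; for the empty list any
   index does. *)
have [m0 m0P] : exists m0, forall n, le_step_nat m0 n -> forall c u,
    c <> \bot%O -> (c <= x n u)%O -> forall y, y \in ys -> `|f u y| < r.
  elim: (ys) => [|y zs [m1 m1P]]; first by exists n0.
  have [m2 m2P] := weak y r r0; have [q1 q2] := le_step_nat_max m1 m2.
  exists (step_map2 maxn m1 m2) => m mP g v g0 Lv z.
  rewrite inE => /orP[/eqP->|].
    exact: m2P (le_step_nat_trans q2 mP) _ _ g0 Lv.
  exact: m1P (le_step_nat_trans q1 mP) _ _ g0 Lv z.
(* At an index late for both purposes, a value on a condition below [c] is weakly small, hence
   farther than $t/2$ from [u], yet within $t/2$ of [u] by the choice of [c]. *)
have [q1 q2] := le_step_nat_max m0 n0.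
have [g [v [g0 gc Lv]]] := step_pick (x (step_map2 maxn m0 n0)) c0.
have := sepw v (m0P _ q1 _ _ g0 Lv); have := n0P _ q2 _ _ g0 gc Lv.
by rewrite distrC; lra.
Qed.

End Separation.

(** * The extended form separates points *)

Section FormSeparation.
Context {d : Order.disp_t} {A : cbaType d} {R : realType}.
Context {X Y : normedModType R} {b : X -> Y -> R}.
Hypotheses (b_linl : forall y, scalar (b^~ y)) (b_linr : forall x, scalar (b x))
  (b_le : forall x y, `|b x y| <= `|x| * `|y|).
Let bc := @formc d A R X Y b b_linl b_linr b_le.

Lemma formc_separating :
  closed ([set x : X | `|x| <= 1] : set (sigma_l b)) ->
  closed ([set y : Y | `|y| <= 1] : set (sigma_r b)) -> cond_separating bc.
Proof.
have zero_le (z : cauchy_seq A R^o) t : class z = zeroc R^o -> 0 < t ->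
    exists n0, forall n, le_step_nat n0 n ->
      forall c s, c <> \bot%O -> (c <= z n s)%O -> `|s| < t.
  move=> z0 t0; have : normc_le \top%O 0 (zeroc R^o : completion A R^o).
    by have := @normc_le_embed d A R R^o \top%O 0; rewrite normr0.
  rewrite -z0 => /normc_leE/(_ _ t0)[n0 n0P]; exists n0 => n /n0P h c s c0.
  exact: h c0 (lex1 _).
move=> clX clY; split.
  move=> x; rewrite -[x]repK => x0; apply: separated_eq0 => [u t|y t t0].
    exact: ball_separation b_linl clX u t.
  (* Pairing with the constants from $Y$ gives the weak smallness of late values of [x]. *)
  have := x0 (embed y); rewrite /bc formcE => /zero_le/(_ t0)[n0 n0P].
  exists n0 => n /n0P h c u c0 Lu.
  apply: (h c _ c0); apply: cauchy_form_le Lu _; exact: step_cst_le.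
move=> y; rewrite -[y]repK => y0.
(* For the flipped form, [sigma_l] is [sigma_r b] by conversion. *)
apply: (@separated_eq0 _ _ _ Y X (fun y x => b x y)) => [v t|x t t0].
  exact: (@ball_separation _ Y X (fun y x => b x y) b_linr clY v t).
have := y0 (embed x); rewrite /bc formcE => /zero_le/(_ t0)[n0 n0P].
exists n0 => n /n0P h c v c0 Lv.
apply: (h c _ c0); apply: cauchy_form_le _ Lv; exact: step_cst_le.
Qed.

End FormSeparation.

(** * Existence and uniqueness of the extended dual pair *)

Theorem theorem3p1 (d : Order.disp_t) (A : cbaType d) (R : realType)
    (X Y : normedModType R) (b : X -> Y -> R)
    (b_dual : dual_pair b)
    (b_le : forall x y, `|b x y| <= `|x| * `|y|)
    (ballX_closed : closed ([set x : X | `|x| <= 1] : set (sigma_l b)))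
    (ballY_closed : closed ([set y : Y | `|y| <= 1] : set (sigma_r b))) :
  exists! B : completion A X -> completion A Y -> condReal A R,
    [/\ forall (x : X) (y : Y), B (embed x) (embed y) = embed (b x y : R^o),
        cond_dual_pair B &
        cond_bounded B].
Proof.
have [b_linl b_linr _ _] := b_dual.
have lin := @formc_bilinear d A R X Y b b_linl b_linr b_le.
have bounded := @formc_bounded d A R X Y b b_linl b_linr b_le.
exists (formc b_linl b_linr b_le); split.
  split=> //; first exact: formc_embed.
  split; last exact: formc_separating.
  by split=> //; exact: formc_stable.
move=> B [Bb [[_ Blin] _] Bbounded].
apply/funext => x; apply/funext => y; apply: cond_bounded_eq => // u v.
by rewrite formc_embed Bb.
Qed.
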